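(* Let $\mathbb{F}$ be a field and let $(\mathsf{\Gamma},\mu,\eta)$ be the free divided power algebra monad on the category $\mathbb{F}\text{-}\mathsf{VEC}$ of $\mathbb{F}$-vector spaces. Then the linear maps $\partial_V:\mathsf{\Gamma}(V)\to\mathsf{\Gamma}(V\times V)$ given on divided power monomials by $$\partial_V(v_1^{[r_1]}*\cdots*v_n^{[r_n]})=\sum_{i=1}^n(v_1,0)^{[r_1]}*\cdots*(v_i,0)^{[r_i-1]}*\cdots*(v_n,0)^{[r_n]}*(0,v_i)^{[1]}$$ and extended by linearity (with the convention that the factor $(v_i,0)^{[r_i-1]}$ is omitted when $r_i=1$) form a differential combinator transformation for the monad $(\mathsf{\Gamma},\mu,\eta)$.
   Context: The monad $\mathsf{\Gamma}$. For an $\mathbb{F}$-vector space $V$, $\mathsf{\Gamma}(V)=\bigoplus_{n\ge1}(V^{\otimes n})^{S(n)}$, the direct sum of the spaces of tensors invariant under the symmetric group $S(n)$; this is the free (non-unital) divided power algebra on $V$. For $v_1,\dots,v_n\in V$ and strictly positive integers $r_1,\dots,r_n$, the divided power monomial $v_1^{[r_1]}*\cdots*v_n^{[r_n]}$ is the element $$\sum_{\sigma\in S(r_1+\dots+r_n)/(S(r_1)\times\cdots\times S(r_n))}\sigma\cdot(v_1^{\otimes r_1}\otimes\cdots\otimes v_n^{\otimes r_n});$$ in particular $v^{[n]}=v^{\otimes n}$ and $v*w=v\otimes w+w\otimes v$. Such monomials span $\mathsf{\Gamma}(V)$ (not uniquely). For linear $f:V\to W$, $\mathsf{\Gamma}(f)(v_1^{[r_1]}*\cdots*v_n^{[r_n]})=f(v_1)^{[r_1]}*\cdots*f(v_n)^{[r_n]}$.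 The unit is $\eta_V(v)=v^{[1]}$. The multiplication $\mu_V:\mathsf{\Gamma}(\mathsf{\Gamma}(V))\to\mathsf{\Gamma}(V)$ is the linear map given on divided power monomials of divided power monomials by $$\mu_V\Big((v_{1,1}^{[q_{1,1}]}*\cdots*v_{1,k_1}^{[q_{1,k_1}]})^{[r_1]}*\cdots*(v_{p,1}^{[q_{p,1}]}*\cdots*v_{p,k_p}^{[q_{p,k_p}]})^{[r_p]}\Big)=\Big(\prod_{i=1}^p\frac{1}{r_i!}\prod_{j=1}^{k_i}\frac{(r_iq_{i,j})!}{(q_{i,j}!)^{r_i}}\Big)\,v_{1,1}^{[r_1q_{1,1}]}*\cdots*v_{1,k_1}^{[r_1q_{1,k_1}]}*\cdots*v_{p,k_p}^{[r_pq_{p,k_p}]},$$ where the coefficient (an integer) is mapped to $\mathbb{F}$. It is known that $(\mathsf{\Gamma},\mu,\eta)$ is a well-defined monad on $\mathbb{F}\text{-}\mathsf{VEC}$. Differential combinator transformations on monads. Let $(\mathsf{S},\mu,\eta)$ be a monad on a category with finite biproducts $\times$, with projections $\pi_0,\pi_1$, injections $\iota_0,\iota_1$, diagonal $\Delta_V=\langle 1_V,1_V\rangle:V\to V\times V$, and copairing $[-,-]$. Let $c_V=\langle\pi_0\times\pi_0,\pi_1\times\pi_1\rangle:(V\times V)\times(V\times V)\to(V\times V)\times(V\times V)$. A differential combinator transformation on $(\mathsf{S},\mu,\eta)$ is a natural transformation $\partial_V:\mathsf{S}(V)\to\mathsf{S}(V\times V)$ such that: [dc.1] $\mathsf{S}(\pi_0)\circ\partial_V=0$;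 [dc.2] $\mathsf{S}(1_V\times\Delta_V)\circ\partial_V=(\mathsf{S}(1_V\times\iota_0)+\mathsf{S}(1_V\times\iota_1))\circ\partial_V$; [dc.3] $\partial_V\circ\eta_V=\eta_{V\times V}\circ\iota_1$; [dc.4] $\partial_V\circ\mu_V=\mu_{V\times V}\circ\mathsf{S}([\mathsf{S}(\iota_0),\partial_V])\circ\partial_{\mathsf{S}(V)}$; [dc.5] $\mathsf{S}(\pi_0\times\pi_1)\circ\partial_{V\times V}\circ\partial_V=\partial_V$; [dc.6] $\mathsf{S}(c_V)\circ\partial_{V\times V}\circ\partial_V=\partial_{V\times V}\circ\partial_V$. (This is the dual of the notion of differential combinator transformation on a comonad.) *)

(* Defs.v *)
From HB Require Import structures.
From mathcomp Require Import all_fingroup all_boot all_order all_algebra.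
From mathcomp Require Import freeg.
From mathcomp Require Import boolp.

Set Implicit Arguments.
Unset Strict Implicit.
Unset Printing Implicit Defensive.

Import GRing.Theory.
Local Open Scope ring_scope.
Local Open Scope quotient_scope.

Definition upd (V : Type) n (v : 'I_n -> V) (i : 'I_n) (x : V) : 'I_n -> V :=
  fun j => if j == i then x else v j.

Definition multilinear (F : fieldType) (V W : lmodType F) n
    (phi : ('I_n -> V) -> W) : Prop :=
  forall (i : 'I_n) (v : 'I_n -> V) (a : F) (x y : V),
    phi (upd v i (a *: x + y)) = a *: phi (upd v i x) + phi (upd v i y).

(* The tensor power of order n of V: the free vector space on V^n modulo the
   subspace generated by the multilinearity relations. *)
Section TensorPower.
Variables (F : fieldType) (V : lmodType F) (n : nat).

Definition free_tensor : lmodType F := {freeg ('I_n -> V) / F}.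

Definition free_pure (v : 'I_n -> V) : free_tensor := << 1 *g v >>.

Definition multilinearity_relation (t : free_tensor) : Prop :=
  exists (i : 'I_n) (v : 'I_n -> V) (a : F) (x y : V),
    t = free_pure (upd v i (a *: x + y))
        - (a *: free_pure (upd v i x) + free_pure (upd v i y)).

Definition tensor_null : {pred free_tensor} := fun t =>
  `[< forall S : {pred free_tensor}, submod_closed S ->
        (forall u, multilinearity_relation u -> u \in S) -> t \in S >].

Fact tensor_null_submod_closed : submod_closed tensor_null.
Proof.
split; first by apply/asboolP => S [S0 _] _.
move=> a u v /asboolP uP /asboolP vP; apply/asboolP => S SC relS.
by case: (SC) => _ SL; apply: SL; [apply: uP | apply: vP].
Qed.

HB.instance Definition _ :=
  GRing.isSubmodClosed.Build F free_tensor tensor_null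
    tensor_null_submod_closed.

Definition tensor : Type := Quotient.quot tensor_null.

HB.instance Definition _ := GRing.Zmodule.on tensor.
HB.instance Definition _ := EqQuotient.on tensor.

Fact tensor_pi_eq (x y : free_tensor) :
  (\pi_tensor x == \pi_tensor y) = (x - y \in tensor_null).
Proof. by rewrite [RHS]Quotient.idealrBE. Qed.

Fact tensor_piD (x y : free_tensor) :
  \pi_tensor (x + y) = \pi_tensor x + \pi_tensor y.
Proof. exact: (@pi_addr _ _ _ _ _ (Quotient.quot tensor_null)). Qed.

Fact tensor_pi0 : \pi_tensor 0 = 0.
Proof. by apply: (addIr (\pi_tensor 0)); rewrite -tensor_piD !add0r. Qed.

Definition tensor_scale (a : F) (t : tensor) : tensor :=
  \pi_tensor (a *: repr t).

Fact tensor_piZ a (x : free_tensor) :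
  \pi_tensor (a *: x) = tensor_scale a (\pi_tensor x).
Proof.
apply/eqP; rewrite tensor_pi_eq -scalerBr rpredZ //.
by rewrite -tensor_pi_eq reprK.
Qed.

Fact tensor_scaleA a b t :
  tensor_scale a (tensor_scale b t) = tensor_scale (a * b) t.
Proof. by rewrite -[t]reprK -(tensor_piZ b) -(tensor_piZ a) scalerA tensor_piZ. Qed.

Fact tensor_scale1 : left_id 1 tensor_scale.
Proof. by move=> t; rewrite -[t]reprK -tensor_piZ scale1r. Qed.

Fact tensor_scaleDr : right_distributive tensor_scale +%R.
Proof.
move=> a t u; rewrite -[t]reprK -[u]reprK.
by rewrite -tensor_piD -tensor_piZ scalerDr tensor_piD !tensor_piZ.
Qed.

Fact tensor_scaleDl t : {morph tensor_scale^~ t : a b / a + b}.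
Proof.
by move=> a b; rewrite -[t]reprK -tensor_piZ scalerDl tensor_piD !tensor_piZ.
Qed.

HB.instance Definition _ := GRing.Zmodule_isLmodule.Build F tensor
  tensor_scaleA tensor_scale1 tensor_scaleDr tensor_scaleDl.

Fact tensor_piP a (x y : free_tensor) :
  \pi_tensor (a *: x + y) = a *: \pi_tensor x + \pi_tensor y.
Proof. by rewrite tensor_piD tensor_piZ. Qed.

Definition pure (v : 'I_n -> V) : tensor := \pi_tensor (free_pure v).

Fact pure_multilinear : multilinear pure.
Proof.
move=> i v a x y; rewrite /pure -tensor_piP.
apply/eqP; rewrite tensor_pi_eq; apply/asboolP => S _; apply.
by exists i, v, a, x, y.
Qed.

Fact tensor_ind (P : tensor -> Prop) :
  P 0 -> (forall a v t, P t -> P (a *: pure v + t)) -> forall t, P t.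
Proof.
move=> P0 PS t; rewrite -[t]reprK -[repr t]freeg_sumE.
elim: (dom _) => [|v s IH].
  by rewrite big_nil tensor_pi0.
rewrite big_cons (_ : << _ *g v >> = coeff v (repr t) *: free_pure v).
  by rewrite tensor_piP; apply: PS.
by apply/eqP/freeg_eqP => w; rewrite coeffZ !coeffU mul1r.
Qed.

End TensorPower.

Section TensorLift.
Variables (F : fieldType) (V W : lmodType F) (n : nat).
Variables (phi : ('I_n -> V) -> W) (mphi : multilinear phi).

Fact fglift_linear : linear (fglift phi : free_tensor V n -> W).
Proof.
have liftB (x y : free_tensor V n) :
  fglift phi (x - y) = fglift phi x - fglift phi y by exact: lift_is_additive.
have lift0 : fglift phi (0 : free_tensor V n) = 0.
  by rewrite -[X in fglift _ X](subrr 0) liftB subrr.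
have liftD (x y : free_tensor V n) :
    fglift phi (x + y) = fglift phi x + fglift phi y.
  by rewrite -[y in LHS]opprK liftB -(sub0r y) liftB lift0 sub0r opprK.
move=> a x y; rewrite liftD; congr (_ + _).
rewrite -[x]freeg_sumE; elim: (dom x) => [|v s IH].
  by rewrite !big_nil scaler0 lift0 scaler0.
rewrite !big_cons scalerDr !liftD scalerDr IH; congr (_ + _).
rewrite (_ : a *: _ = << a * coeff v x *g v >>) ?liftU ?scalerA //.
by apply/eqP/freeg_eqP => w; rewrite coeffZ !coeffU mulrA.
Qed.

Definition tensor_lift_of of multilinear phi : tensor V n -> W :=
  fun t => fglift phi (repr t).
Local Notation lift := (tensor_lift_of mphi).

Fact tensor_liftE x : lift (\pi_(tensor V n) x) = fglift phi x.
Proof.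
have liftL : linear (fglift phi : free_tensor V n -> W) := fglift_linear.
pose S : {pred free_tensor V n} := fun t => fglift phi t == 0.
have SC : submod_closed S.
  have l0 : fglift phi (0 : free_tensor V n) = 0.
    apply: (addIr (fglift phi (0 : free_tensor V n))).
    by rewrite -{1}[fglift phi 0]scale1r -liftL scale1r !add0r.
  split; first by rewrite unfold_in l0.
  move=> a u v; rewrite !unfold_in liftL => /eqP-> /eqP->.
  by rewrite scaler0 addr0.
have : repr (\pi_(tensor V n) x) - x \in @tensor_null F V n.
  by rewrite -tensor_pi_eq reprK.
move/asboolP => /(_ S SC); rewrite unfold_in.
rewrite -scaleN1r addrC liftL scaleN1r addrC subr_eq0 => H; apply/eqP/H.
move=> _ [i [v [a [u [w ->]]]]]; rewrite unfold_in.
rewrite -scaleN1r addrC liftL liftL !liftU !scale1r mphi.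
by rewrite scaleN1r addNr.
Qed.

Fact tensor_lift_linear : linear lift.
Proof.
move=> a x y; rewrite -[x]reprK -[y]reprK -tensor_piP.
by rewrite !tensor_liftE fglift_linear.
Qed.

HB.instance Definition _ :=
  GRing.isLinear.Build F (tensor V n) W *:%R lift tensor_lift_linear.

Definition tensor_lift : {linear tensor V n -> W} := lift.

Fact tensor_lift_pure v : tensor_lift (pure v) = phi v.
Proof. by rewrite /tensor_lift /= tensor_liftE liftU scale1r. Qed.

End TensorLift.

Section TensorMaps.
Variables (F : fieldType) (n : nat).

Fact upd_comp (V W : Type) (f : V -> W) (v : 'I_n -> V) i x :
  f \o upd v i x = upd (f \o v) i (f x).
Proof. by apply: funext => j; rewrite /= /upd; case: eqP. Qed.

Fact tensor_map_multilinear (V W : lmodType F) (f : {linear V -> W}) :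
  multilinear (fun v : 'I_n -> V => pure (f \o v)).
Proof. by move=> i v a x y; rewrite !upd_comp linearP pure_multilinear. Qed.

Definition tensor_map (V W : lmodType F) (f : {linear V -> W}) :
    {linear tensor V n -> tensor W n} :=
  tensor_lift (tensor_map_multilinear f).

(* The left action of S(n): the i-th factor is moved to position s i. *)
Fact tensor_perm_multilinear (V : lmodType F) (s : 'S_n) :
  multilinear (fun v : 'I_n -> V => pure (v \o (s^-1)%g)).
Proof.
have E (v : 'I_n -> V) i x :
    upd v i x \o (s^-1)%g = upd (v \o (s^-1)%g) (s i) x.
  by apply: funext => j; rewrite /= /upd -(inj_eq (@perm_inj _ s)) permKV.
by move=> i v a x y; rewrite !E pure_multilinear.
Qed.

Definition tensor_perm (V : lmodType F) (s : 'S_n) :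
    {linear tensor V n -> tensor V n} :=
  tensor_lift (tensor_perm_multilinear (V := V) s).

End TensorMaps.

Section SymTensor.
Variables (F : fieldType) (V : lmodType F) (n : nat).

Definition symmetric_tensor : {pred tensor V n} :=
  fun t => [forall s : 'S_n, tensor_perm V s t == t].

Fact symmetric_tensor_submod_closed : submod_closed symmetric_tensor.
Proof.
split; first by apply/forallP => s; rewrite linear0.
move=> a u v /forallP uP /forallP vP; apply/forallP => s.
by rewrite linearP (eqP (uP s)) (eqP (vP s)).
Qed.

HB.instance Definition _ :=
  GRing.isSubmodClosed.Build F (tensor V n) symmetric_tensor
    symmetric_tensor_submod_closed.

Record sym_tensor : Type :=
  SymTensor { sym_val : tensor V n; _ : sym_val \in symmetric_tensor }.

HB.instance Definition _ := [isSub for sym_val].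
HB.instance Definition _ := [Choice of sym_tensor by <:].
HB.instance Definition _ := [SubChoice_isSubLmodule of sym_tensor by <:].

End SymTensor.

Section DirectSum.
Variables (F : fieldType) (E : nat -> lmodType F).

Definition family : Type := forall n, E n.

HB.instance Definition _ := gen_eqMixin family.
HB.instance Definition _ := gen_choiceMixin family.

Let family_ext (f g : family) : (forall n, f n = g n) -> f = g.
Proof. exact: functional_extensionality_dep. Qed.

Definition family_zero : family := fun n => 0.
Definition family_opp (f : family) : family := fun n => - f n.
Definition family_add (f g : family) : family := fun n => f n + g n.
Definition family_scale (a : F) (f : family) : family := fun n => a *: f n.

Fact family_addA : associative family_add.
Proof. by move=> f g h; apply: family_ext => n; apply: addrA. Qed.

Fact family_addC : commutative family_add.
Proof. by move=> f g; apply: family_ext => n; apply: addrC. Qed.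

Fact family_add0 : left_id family_zero family_add.
Proof. by move=> f; apply: family_ext => n; apply: add0r. Qed.

Fact family_addN : left_inverse family_zero family_opp family_add.
Proof. by move=> f; apply: family_ext => n; apply: addNr. Qed.

HB.instance Definition _ :=
  GRing.isZmodule.Build family family_addA family_addC family_add0 family_addN.

Fact family_scaleA a b f :
  family_scale a (family_scale b f) = family_scale (a * b) f.
Proof. by apply: family_ext => n; apply: scalerA. Qed.

Fact family_scale1 : left_id 1 family_scale.
Proof. by move=> f; apply: family_ext => n; apply: scale1r. Qed.

Fact family_scaleDr : right_distributive family_scale +%R.
Proof. by move=> a f g; apply: family_ext => n; apply: scalerDr. Qed.

Fact family_scaleDl f : {morph family_scale^~ f : a b / a + b}.
Proof. by move=> a b; apply: family_ext => n; apply: scalerDl. Qed.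

HB.instance Definition _ := GRing.Zmodule_isLmodule.Build F family
  family_scaleA family_scale1 family_scaleDr family_scaleDl.

Definition finitely_supported : {pred family} :=
  fun f => `[< exists N : nat, forall n : nat, (N <= n)%N -> f n = 0 >].

Fact finitely_supported_submod_closed : submod_closed finitely_supported.
Proof.
split; first by apply/asboolP; exists 0%N.
move=> a u v /asboolP[N uN] /asboolP[M vM]; apply/asboolP.
exists (maxn N M) => n; rewrite geq_max => /andP[Nn Mn].
change (a *: u n + v n = 0).
by rewrite uN // vM // scaler0 addr0.
Qed.

HB.instance Definition _ :=
  GRing.isSubmodClosed.Build F family finitely_supported
    finitely_supported_submod_closed.

Record dirsum : Type :=
  DirSum { dirsum_val : family; _ : dirsum_val \in finitely_supported }.

HB.instance Definition _ := [isSub for dirsum_val].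
HB.instance Definition _ := [Choice of dirsum by <:].
HB.instance Definition _ := [SubChoice_isSubLmodule of dirsum by <:].

End DirectSum.

(* The component of index n of an element of Gamma V has degree n.+1. *)
Definition Gamma (F : fieldType) (V : lmodType F) : lmodType F :=
  dirsum (fun n => sym_tensor V n.+1 : lmodType F).

Section GammaMap.
Variables (F : fieldType).

Fact tensor_eq_lin (V W : lmodType F) n (f g : {linear tensor V n -> W}) :
  (forall v, f (pure v) = g (pure v)) -> f =1 g.
Proof.
move=> fg; apply: tensor_ind => [|a v t IH]; first by rewrite !linear0.
by rewrite !linearP fg IH.
Qed.

Fact tensor_perm_map (V W : lmodType F) n (f : {linear V -> W}) (s : 'S_n) t :
  tensor_perm W s (tensor_map n f t) = tensor_map n f (tensor_perm V s t).
Proof.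
move: t; apply: (tensor_eq_lin (f := tensor_perm W s \o tensor_map n f)
  (g := tensor_map n f \o tensor_perm V s)) => v /=.
by rewrite !tensor_lift_pure.
Qed.

Variables (V W : lmodType F) (f : {linear V -> W}).

Fact sym_map_subproof n (t : sym_tensor V n) :
  tensor_map n f (sym_val t) \in @symmetric_tensor F W n.
Proof.
apply/forallP => s; rewrite tensor_perm_map; case: t => t /= /forallP tP.
by rewrite (eqP (tP s)).
Qed.

Definition sym_map n (t : sym_tensor V n) : sym_tensor W n :=
  SymTensor (sym_map_subproof t).

Fact sym_map_linear n : linear (@sym_map n).
Proof. by move=> a x y; apply: val_inj; rewrite /= linearP. Qed.

HB.instance Definition _ n :=
  GRing.isLinear.Build F (sym_tensor V n) (sym_tensor W n) *:%R
    (@sym_map n) (@sym_map_linear n).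

Definition Gamma_family (x : Gamma V) :
    family (fun n => sym_tensor W n.+1 : lmodType F) :=
  fun n => sym_map (dirsum_val x n).

Fact Gamma_map_subproof (x : Gamma V) :
  Gamma_family x \in @finitely_supported F _.
Proof.
case: x => x xP; have /asboolP[N xN] := xP; apply/asboolP; exists N => n Nn.
by rewrite /Gamma_family /= xN // linear0.
Qed.

Definition Gamma_fun (x : Gamma V) : Gamma W := DirSum (Gamma_map_subproof x).

Fact Gamma_fun_linear : linear Gamma_fun.
Proof.
move=> a x y; apply: val_inj; apply: functional_extensionality_dep => n.
exact: (linearP (@sym_map n.+1)).
Qed.

HB.instance Definition _ :=
  GRing.isLinear.Build F (Gamma V) (Gamma W) *:%R Gamma_fun Gamma_fun_linear.

Definition Gamma_map : {linear Gamma V -> Gamma W} := Gamma_fun.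

End GammaMap.

(* A divided power monomial v_1^[r_1] * ... * v_n^[r_n] is given by the
   sequence s of the pairs (v_i, r_i); dp_word s is the word
   v_1 ... v_1 v_2 ... v_n with r_i letters v_i. A pair with exponent 0
   contributes nothing. *)
Section Monomials.
Variables (F : fieldType) (V : lmodType F).
Implicit Types (s : seq (V * nat)).

Definition dp_degree s : nat := \sum_(p <- s) p.2.

Definition dp_word s : seq V := flatten [seq nseq p.2 p.1 | p <- s].

(* S(r_1) x ... x S(r_n); reshape_index r j is the index of the block of size
   r_i that contains position j *)
Definition young_set n (r : seq nat) : {set 'S_n} :=
  [set h : 'S_n |
    [forall j, reshape_index r (h j) == reshape_index r j]].

Fact young_group_set n r : group_set (young_set n r).
Proof.
apply/group_setP; split; first by rewrite inE; apply/forallP => j; rewrite perm1.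
move=> g h; rewrite !inE => /forallP gP /forallP hP; apply/forallP => j.
by rewrite permM (eqP (hP _)).
Qed.

Canonical young n r : {group 'S_n} := fingroup.Group (young_group_set n r).

(* Permutations compose from left to right in MathComp: (s * t) i = t (s i), so
   the classes of S(n) modulo precomposition with an element of the Young
   subgroup are the right cosets. *)
Definition dp_tensor n s : tensor V n :=
  \sum_(C in rcosets (young n (unzip2 s)) [set: 'S_n])
     tensor_perm V (fingroup.repr C)
       (pure (fun j : 'I_n => nth 0 (dp_word s) j)).

Fact reshape_index_ge (r : seq nat) j :
  (sumn r <= j)%N -> (size r <= reshape_index r j)%N.
Proof.
rewrite /reshape_index; elim: r j => //= a r IH j rj.
have aj : (a <= j)%N by apply: leq_trans rj; apply: leq_addr.
by rewrite subSn // ltnS; apply: IH; rewrite leq_subRL.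
Qed.

Fact nth_dp_word s j :
  nth 0 (dp_word s) j = nth 0 (unzip1 s) (reshape_index (unzip2 s) j).
Proof.
have Esh : unzip2 s = shape [seq nseq p.2 p.1 | p <- s].
  by rewrite /shape -map_comp; apply: eq_map => p /=; rewrite size_nseq.
have [ltj | gej] := ltnP j (sumn (unzip2 s)); last first.
  rewrite !nth_default //; last by rewrite size_flatten -Esh.
  by rewrite size_map -(size_map snd) reshape_index_ge.
have := reshape_indexP ltj; rewrite size_map => lti.
rewrite nth_flatten -Esh (nth_map (0, 0%N)) // nth_nseq.
have := reshape_offsetP ltj.
rewrite (nth_map (0, 0%N)) // => ->; by rewrite (nth_map (0, 0%N)).
Qed.

Fact tensor_permM n (g h : 'S_n) (t : tensor V n) :
  tensor_perm V (g * h)%g t = tensor_perm V h (tensor_perm V g t).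
Proof.
move: t; apply: (tensor_eq_lin (g := tensor_perm V h \o tensor_perm V g)).
move=> v /=; rewrite !tensor_lift_pure; congr pure; apply: funext => j /=.
by rewrite invMg permM.
Qed.

Fact dp_tensor_symmetric n s : dp_tensor n s \in @symmetric_tensor F V n.
Proof.
apply/forallP => g; apply/eqP; rewrite /dp_tensor linear_sum.
set H := young n (unzip2 s); set t := pure _.
have tH h : h \in H -> tensor_perm V h t = t.
  move=> /groupVr; rewrite inE => /forallP hP.
  rewrite tensor_lift_pure; congr pure; apply: funext => j /=.
  by rewrite !nth_dp_word (eqP (hP j)).
rewrite [RHS](reindex_inj (h := fun C : {set 'S_n} => (C :* g)%g));
  last exact: rcoset_inj.
apply: eq_big => [C|C].
  apply/rcosetsP/rcosetsP => [] [x _ E].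
    by exists (x * g)%g; rewrite ?inE // E rcosetM.
  exists (x * g^-1)%g; rewrite ?inE // rcosetM -E.
  by rewrite -rcosetM mulgV rcoset1.
case/rcosetsP => x _ ->.
rewrite -[LHS]tensor_permM -rcosetM.
have [h hH] := repr_rcosetP H x; have [k kH] := repr_rcosetP H (x * g)%g.
by rewrite -mulgA [LHS]tensor_permM [RHS]tensor_permM (tH h hH) (tH k kH).
Qed.

Definition dp_monomial_family s :
    family (fun n => sym_tensor V n.+1 : lmodType F) :=
  fun n => if n.+1 == dp_degree s then SymTensor (dp_tensor_symmetric n.+1 s)
           else 0.

Fact dp_monomial_subproof s : dp_monomial_family s \in @finitely_supported F _.
Proof.
apply/asboolP; exists (dp_degree s) => n degn.
by rewrite /dp_monomial_family gtn_eqF.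
Qed.

Definition dp_monomial s : Gamma V := DirSum (dp_monomial_subproof s).

End Monomials.

Fact Gamma_map_monomial (F : fieldType) (V W : lmodType F) (f : {linear V -> W})
    (s : seq (V * nat)) :
  Gamma_map f (dp_monomial s) = dp_monomial [seq (f p.1, p.2) | p <- s].
Proof.
have E2 : unzip2 [seq (f p.1, p.2) | p <- s] = unzip2 s.
  by rewrite /unzip2 -map_comp.
have Ed : dp_degree [seq (f p.1, p.2) | p <- s] = dp_degree s.
  by rewrite /dp_degree big_map.
have Ew : dp_word [seq (f p.1, p.2) | p <- s] = map f (dp_word s).
  rewrite /dp_word map_flatten -!map_comp; congr flatten; apply: eq_map => p /=.
  by rewrite map_nseq.
apply: val_inj; apply: functional_extensionality_dep => n.
rewrite /= /Gamma_family /= /dp_monomial_family Ed.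
case: eqP => _; last by rewrite linear0.
apply: val_inj => /=; rewrite linear_sum /dp_tensor E2.
apply: eq_bigr => C _; rewrite -tensor_perm_map; congr (tensor_perm _ _ _).
rewrite /tensor_map tensor_lift_pure Ew; congr pure; apply: funext => j /=.
have [jlt|jge] := ltnP j (size (dp_word s)); first by rewrite (nth_map 0).
by rewrite !nth_default ?size_map // linear0.
Qed.

Section Biproducts.
Variable F : fieldType.
Implicit Types V W X Y : lmodType F.

Definition biprod V W : lmodType F := (V * W)%type.

Definition proj0 V W : {linear biprod V W -> V} := fst.
Definition proj1 V W : {linear biprod V W -> W} := snd.

Definition pairing_fun X V W (f : {linear X -> V}) (g : {linear X -> W}) :
  X -> biprod V W := fun x => (f x, g x).

Fact pairing_linear X V W (f : {linear X -> V}) (g : {linear X -> W}) :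
  linear (pairing_fun f g).
Proof. by move=> a x y; rewrite /pairing_fun !linearP. Qed.

HB.instance Definition _ X V W (f : {linear X -> V}) (g : {linear X -> W}) :=
  GRing.isLinear.Build F X (biprod V W) *:%R (pairing_fun f g)
    (pairing_linear f g).

Definition pairing X V W (f : {linear X -> V}) (g : {linear X -> W}) :
  {linear X -> biprod V W} := pairing_fun f g.

Definition copairing_fun V W X (f : {linear V -> X}) (g : {linear W -> X}) :
  biprod V W -> X := fun x => f x.1 + g x.2.

Fact copairing_linear V W X (f : {linear V -> X}) (g : {linear W -> X}) :
  linear (copairing_fun f g).
Proof.
by move=> a x y; rewrite /copairing_fun /= !linearP scalerDr addrACA.
Qed.

HB.instance Definition _ V W X (f : {linear V -> X}) (g : {linear W -> X}) :=
  GRing.isLinear.Build F (biprod V W) X *:%R (copairing_fun f g)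
    (copairing_linear f g).

Definition copairing V W X (f : {linear V -> X}) (g : {linear W -> X}) :
  {linear biprod V W -> X} := copairing_fun f g.

Definition id_lin V : {linear V -> V} := idfun.
Definition zero_lin V W : {linear V -> W} := \0.
Definition inj0 V W : {linear V -> biprod V W} :=
  pairing (id_lin V) (zero_lin V W).
Definition inj1 V W : {linear W -> biprod V W} :=
  pairing (zero_lin W V) (id_lin W).
Definition diag V : {linear V -> biprod V V} := pairing (id_lin V) (id_lin V).

Definition biprod_map V W X Y (f : {linear V -> X}) (g : {linear W -> Y}) :
  {linear biprod V W -> biprod X Y} :=
  pairing (f \o proj0 V W) (g \o proj1 V W).

(* ((a, b), (c, d)) |-> ((a, c), (b, d)) *)
Definition interchange V :
  {linear biprod (biprod V V) (biprod V V) ->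
          biprod (biprod V V) (biprod V V)} :=
  pairing (biprod_map (proj0 V V) (proj0 V V))
          (biprod_map (proj1 V V) (proj1 V V)).

End Biproducts.

Record vec_functor (F : fieldType) := VecFunctor {
  fobj :> lmodType F -> lmodType F;
  fmap : forall V W : lmodType F, {linear V -> W} -> {linear fobj V -> fobj W};
  fmap_id : forall (V : lmodType F) (x : fobj V), fmap (id_lin V) x = x;
  fmap_comp : forall (V W X : lmodType F) (f : {linear V -> W})
    (g : {linear W -> X}) (x : fobj V), fmap (g \o f) x = fmap g (fmap f x)
}.
Arguments fmap {F} S {V W} f : rename.

Record monad (F : fieldType) (S : vec_functor F) := Monad {
  munit : forall V : lmodType F, {linear V -> S V};
  mmult : forall V : lmodType F, {linear S (S V) -> S V};
  munit_natural : forall (V W : lmodType F) (f : {linear V -> W}) (v : V),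
    fmap S f (munit V v) = munit W (f v);
  mmult_natural : forall (V W : lmodType F) (f : {linear V -> W}) (x : S (S V)),
    fmap S f (mmult V x) = mmult W (fmap S (fmap S f) x);
  mmult_unitl : forall (V : lmodType F) (x : S V), mmult V (munit (S V) x) = x;
  mmult_unitr : forall (V : lmodType F) (x : S V),
    mmult V (fmap S (munit V) x) = x;
  mmult_assoc : forall (V : lmodType F) (x : S (S (S V))),
    mmult V (mmult (S V) x) = mmult V (fmap S (mmult V) x)
}.
Arguments munit {F S} M V : rename.
Arguments mmult {F S} M V : rename.

Record is_differential_combinator (F : fieldType) (S : vec_functor F)
    (M : monad S) (d : forall V : lmodType F, {linear S V -> S (biprod V V)}) :
    Prop := IsDifferentialCombinator {
  dc_natural : forall (V W : lmodType F) (f : {linear V -> W}) (x : S V),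
    d W (fmap S f x) = fmap S (biprod_map f f) (d V x);
  dc1 : forall (V : lmodType F) (x : S V), fmap S (proj0 V V) (d V x) = 0;
  dc2 : forall (V : lmodType F) (x : S V),
    fmap S (biprod_map (id_lin V) (diag V)) (d V x)
    = fmap S (biprod_map (id_lin V) (inj0 V V)) (d V x)
      + fmap S (biprod_map (id_lin V) (inj1 V V)) (d V x);
  dc3 : forall (V : lmodType F) (v : V),
    d V (munit M V v) = munit M (biprod V V) (inj1 V V v);
  dc4 : forall (V : lmodType F) (x : S (S V)),
    d V (mmult M V x)
    = mmult M (biprod V V)
        (fmap S (copairing (fmap S (inj0 V V)) (d V)) (d (S V) x));
  dc5 : forall (V : lmodType F) (x : S V),
    fmap S (biprod_map (proj0 V V) (proj1 V V)) (d (biprod V V) (d V x))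
    = d V x;
  dc6 : forall (V : lmodType F) (x : S V),
    fmap S (interchange V) (d (biprod V V) (d V x)) = d (biprod V V) (d V x)
}.

Section GammaMonad.
Variable F : fieldType.

Fact Gamma_map_id (V : lmodType F) (x : Gamma V) : Gamma_map (id_lin V) x = x.
Proof.
apply: val_inj; apply: functional_extensionality_dep => n.
apply: val_inj => /=; apply: (tensor_eq_lin (g := id_lin _)) => v.
by rewrite tensor_lift_pure.
Qed.

Fact Gamma_map_comp (V W X : lmodType F) (f : {linear V -> W})
    (g : {linear W -> X}) (x : Gamma V) :
  Gamma_map (g \o f) x = Gamma_map g (Gamma_map f x).
Proof.
apply: val_inj; apply: functional_extensionality_dep => n.
apply: val_inj => /=.
apply: (tensor_eq_lin (g := tensor_map n.+1 g \o tensor_map n.+1 f)) => v /=.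
by rewrite !tensor_lift_pure.
Qed.

Definition Gamma_functor : vec_functor F :=
  VecFunctor Gamma_map_id Gamma_map_comp.

Definition proper_monomial (T : Type) (s : seq (T * nat)) : bool :=
  (0 < size s)%N && all (fun p => 0 < p.2)%N s.

(* Both divisions are exact. *)
Definition composition_factor (V : Type) (p : seq (V * nat) * nat) : nat :=
  ((\prod_(q <- p.1) ((p.2 * q.2)`! %/ q.2`! ^ p.2)) %/ p.2`!)%N.

Definition is_divided_power_monad (M : monad Gamma_functor) : Prop :=
  (forall (V : lmodType F) (v : V), munit M V v = dp_monomial [:: (v, 1%N)])
  /\
  (forall (V : lmodType F) (s : seq (seq (V * nat) * nat)),
     proper_monomial s -> all (fun p => proper_monomial p.1) s ->
     mmult M V (dp_monomial [seq (dp_monomial p.1, p.2) | p <- s])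
     = (\prod_(p <- s) composition_factor p)%:R
       *: dp_monomial
            (flatten [seq [seq (q.1, (p.2 * q.2)%N) | q <- p.1] | p <- s])).

(* (v_1,0)^[r_1] * ... * (v_i,0)^[r_i - 1] * ... * (v_n,0)^[r_n] * (0,v_i)^[1],
   for s the sequence of the pairs (v_j, r_j) *)
Definition derivative_term (V : lmodType F) (s : seq (V * nat)) (i : nat) :
    seq (biprod V V * nat) :=
  let p j := nth (0, 0%N) s j in
  rcons (mkseq (fun j => (((p j).1, 0), ((p j).2 - (j == i))%N)) (size s))
        ((0, (p i).1), 1%N).

Definition is_divided_power_derivative
    (d : forall V : lmodType F, {linear Gamma V -> Gamma (biprod V V)}) : Prop :=
  forall (V : lmodType F) (s : seq (V * nat)), proper_monomial s ->
    d V (dp_monomial s)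
    = \sum_(i < size s) dp_monomial (derivative_term s i).

End GammaMonad.

(* Main.v *)
From HB Require Import structures.
Require Import Defs.
From mathcomp Require Import all_fingroup all_boot all_order all_algebra.
From mathcomp Require Import freeg boolp.
From mathcomp Require classical_sets.

Set Implicit Arguments.
Unset Strict Implicit.
Unset Printing Implicit Defensive.

Import GRing.Theory.
Local Open Scope ring_scope.

(** On pure tensors put
      D(v_1 (x) ... (x) v_n) =
        sum_j (v_1,0) (x) ... (x) (0,v_j) (x) ... (x) (v_n,0).
    This is well defined on the whole tensor power, is linear, and commutes
    with the symmetric group, so it restricts to invariant tensors and gives a
    map on Gamma with no choice of monomials involved.  On this tensor level
    naturality and the axioms that do not mention the monad ([dc1], [dc2],
    [dc5], [dc6]) are slot by slot comparisons of pure tensors.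

    What remains is to compare D with divided power monomials.  A monomial of
    degree n is the sum of pure(v o w) over the words w of length n whose i-th
    letter occurs r_i times (component_monomial): cosets of the Young subgroup
    are the rearrangements of one such word.  In this form the rules of the
    divided power calculus are counts of words: the order of the factors is
    irrelevant (dp_monomial_perm), x^[a] * x^[b] = C(a+b,a) x^[a+b]
    (dp_monomial_merge), a factor of exponent 1 is linear
    (linear_factor_linear), and D marks one occurrence of one letter, which is
    the stated formula (word_sum_derivative, derivative_monomial).  Its case of
    a single letter of exponent 1 is [dc3].

    Uniqueness, and the axiom [dc4] relating D to the multiplication, are then
    checked on monomials, which requires that these span (Gamma_span): if B
    spans V, the monomials with letters in B span Gamma V.  Choosing a basis
    inside B, a tensor is a combination of pure tensors of basis letters, and
    for an invariant tensor the coefficient of a word depends only on its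
    content, so the words of a given content group into one monomial.  Having
    B arbitrary matters: with V replaced by Gamma V and B the set of monomials,
    it reduces [dc4] to monomials of monomials.

    For these, both sides of [dc4] are sums over a factor u^[r] of the outer
    monomial and a factor v^[k] of u (chain_rule).  On the side where D comes
    first, u^[r] has become u^[r-1] * D(u), and the multiplication must merge
    the factors of u^[r-1] with those of D(u); the binomials produced by these
    merges are exactly the ratio of the coefficients of u^[r] and u^[r-1]
    (pointed_merge, composition_factor_step). *)

(** * Divided power monomials as sums over words *)

Section Words.
Variables (F : fieldType) (V : lmodType F).
Implicit Types (I : finType) (n : nat).

Definition letter_count I n (w : {ffun 'I_n -> I}) (i : I) : nat :=
  \sum_j (w j == i).

Definition has_content I n (r : I -> nat) (w : {ffun 'I_n -> I}) : bool :=
  [forall i, letter_count w i == r i].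

(** The monomial with the factors (v i)^[r i], in tensor degree n.  Indexing
    the letters by an arbitrary finite type lets operations on monomials
    (reordering, merging, adding a factor) be maps between index types. *)
Definition word_sum I (v : I -> V) (r : I -> nat) n : tensor V n :=
  \sum_(w : {ffun 'I_n -> I} | has_content r w) pure (v \o w).

Lemma letter_count_codom I n (w : {ffun 'I_n -> I}) i :
  letter_count w i = count_mem i (codom w).
Proof.
rewrite count_map -sum1_count big_mkcond /letter_count big_enum /=.
by apply: eq_bigr => j _; case: eqP.
Qed.

Lemma has_contentP I n (r : I -> nat) (w : {ffun 'I_n -> I}) :
  reflect (forall i, letter_count w i = r i) (has_content r w).
Proof. exact: 'forall_eqP. Qed.

Lemma letter_count_perm I n (w : {ffun 'I_n -> I}) (s : 'S_n) i :
  letter_count [ffun j => w (s j)] i = letter_count w i.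
Proof.
rewrite /letter_count [RHS](reindex_inj (@perm_inj _ s)).
by apply: eq_bigr => j _; rewrite ffunE.
Qed.

(** Two words with the same content have the same multiset of letters, hence
    are rearrangements of each other. *)
Lemma letter_count_eq I n (w w' : {ffun 'I_n -> I}) :
  letter_count w =1 letter_count w' ->
  exists s : 'S_n, forall j, w' j = w (s j).
Proof.
move=> ww'.
have : perm_eq [tuple w' j | j < n] [tuple w j | j < n].
  have cE (u : {ffun 'I_n -> I}) : [tuple u j | j < n] = codom u :> seq I by [].
  by rewrite !cE; apply/allP => i _ /=; rewrite -!letter_count_codom ww'.
case/tuple_permP => s /val_inj E; exists s => j.
by rewrite -(tnth_mktuple w' j) E !tnth_mktuple.
Qed.

(** The word with r i consecutive letters i is the block function whose
    fibres define the Young subgroup. *)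
Lemma nth_block_word I (e : seq I) (r : I -> nat) i0 j :
  nth i0 (flatten [seq nseq (r i) i | i <- e]) j =
  nth i0 e (reshape_index [seq r i | i <- e] j).
Proof.
have Esh : [seq r i | i <- e] = shape [seq nseq (r i) i | i <- e].
  by rewrite /shape -map_comp; apply: eq_map => p /=; rewrite size_nseq.
have [ltj | gej] := ltnP j (sumn [seq r i | i <- e]); last first.
  rewrite !nth_default //; last by rewrite size_flatten -Esh.
  by rewrite -(size_map r) reshape_index_ge.
have := reshape_indexP ltj; rewrite size_map => lti.
rewrite nth_flatten -Esh (nth_map i0) // nth_nseq.
have := reshape_offsetP ltj.
by rewrite (nth_map i0) // => ->.
Qed.

(** The Young subgroup is the stabilizer of the block word b, and the orbit of
    b consists of the words of content r; so C |-> b o (repr C)^-1 is a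
    bijection from the right cosets onto these words. *)
Lemma dp_tensor_words I (e : seq I) (v : I -> V) (r : I -> nat) n :
  perm_eq e (enum I) -> n.+1 = dp_degree [seq (v i, r i) | i <- e] ->
  dp_tensor n.+1 [seq (v i, r i) | i <- e] = word_sum v r n.+1.
Proof.
move=> pe; set s := map _ _ => degn.
have ue : uniq e by rewrite (perm_uniq pe) enum_uniq.
have Er : unzip2 s = [seq r i | i <- e] by rewrite /unzip2 -map_comp.
have Ed : (\sum_(i <- e) r i)%N = n.+1 by rewrite degn /dp_degree big_map.
have Es : sumn [seq r i | i <- e] = n.+1 by rewrite sumnE big_map.
have [i0 _] : exists i0 : I, true.
  by case: (e) Ed => [|i0 e' _]; [rewrite big_nil | exists i0].
set bw := flatten [seq nseq (r i) i | i <- e].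
have Ew : dp_word s = map v bw.
  rewrite /dp_word map_flatten -!map_comp; congr flatten; apply: eq_map => i /=.
  by rewrite map_nseq.
have sbw : size bw = n.+1.
  rewrite size_flatten -Es; congr sumn; rewrite /shape -map_comp.
  by apply: eq_map => i /=; rewrite size_nseq.
pose b : {ffun 'I_n.+1 -> I} := [ffun j : 'I_n.+1 => nth i0 bw j].
have bY h : (h \in young n.+1 (unzip2 s)) = [forall j, b (h j) == b j].
  rewrite inE; apply: eq_forallb => j; rewrite !ffunE !nth_block_word Er.
  have lt k : (k < n.+1)%N -> (reshape_index [seq r i | i <- e] k < size e)%N.
    by move=> kn; rewrite -(size_map r); apply: reshape_indexP; rewrite Es.
  by rewrite nth_uniq // lt.
have bc : has_content r b.
  apply/has_contentP => i; rewrite letter_count_codom.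
  have -> : codom b = bw.
    apply: (@eq_from_nth _ i0); first by rewrite size_map size_enum_ord sbw.
    rewrite size_map size_enum_ord => k kn.
    rewrite (nth_map ord0) ?size_enum_ord //.
    by rewrite ffunE nth_enum_ord.
  rewrite count_flatten sumnE !big_map (perm_big _ pe) big_enum /=.
  rewrite (bigD1 i) //= count_nseq /= eqxx mul1n big1 ?addn0 // => k /negPf ki.
  by rewrite count_nseq /= ki.
pose f (C : {set 'S_n.+1}) : {ffun 'I_n.+1 -> I} :=
  [ffun j => b ((fingroup.repr C)^-1%g j)].
have frc x : f (young n.+1 (unzip2 s) :* x)%g = [ffun j => b (x^-1%g j)].
  apply/ffunP => j; rewrite ffunE [RHS]ffunE.
  have [h hY] := repr_rcosetP (young n.+1 (unzip2 s)) x.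
  move: (groupVr hY); rewrite bY => /forallP/(_ (x^-1%g j))/eqP hj.
  by rewrite invMg permM hj.
rewrite /dp_tensor /word_sum.
transitivity (\sum_(w in f @: rcosets (young n.+1 (unzip2 s)) [set: 'S_n.+1])
   pure (v \o w)).
  rewrite [RHS]big_imset /=.
    apply: eq_bigr => C _; rewrite tensor_lift_pure; congr pure.
    apply: funext => j /=; rewrite !ffunE Ew (nth_map i0) //.
    by rewrite sbw.
  move=> _ _ /rcosetsP[x _ ->] /rcosetsP[y _ ->]; rewrite !frc => E.
  apply: rcoset_eqP; rewrite mem_rcoset bY; apply/forallP => j.
  by move/ffunP: E => /(_ (x j)); rewrite !ffunE !permM permK => ->.
apply: eq_bigl => w; apply/imsetP/has_contentP => [[_ /rcosetsP[x _ ->] ->] i|cw].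
  by rewrite frc letter_count_perm (has_contentP _ _ bc).
have [|x E] := @letter_count_eq _ _ b w.
  by move=> i; rewrite cw (has_contentP _ _ bc).
exists (young n.+1 (unzip2 s) :* x^-1)%g.
  by apply/rcosetsP; exists x^-1%g; rewrite ?inE.
by rewrite frc; apply/ffunP => j; rewrite ffunE invgK E.
Qed.

End Words.

(** * The calculus of divided power monomials *)

Section Components.
Variables (F : fieldType) (V : lmodType F).

Definition component n (x : Gamma V) : tensor V n.+1 := sym_val (dirsum_val x n).

Fact component_linear n : linear (component n).
Proof. by []. Qed.

HB.instance Definition _ n := GRing.isLinear.Build F (Gamma V) (tensor V n.+1)
  *:%R (component n) (component_linear n).

Lemma Gamma_ext (x y : Gamma V) :
  (forall n, component n x = component n y) -> x = y.
Proof.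
move=> xy; apply: val_inj; apply: functional_extensionality_dep => n.
exact/val_inj/xy.
Qed.

Lemma word_sum_degree (I : finType) (v : I -> V) r n :
  (\sum_i r i)%N != n -> word_sum v r n = 0.
Proof.
move=> degn; rewrite /word_sum big_pred0 // => w; apply/has_contentP => cw.
case/eqP: degn; rewrite -(eq_bigr _ (fun i _ => cw i)) exchange_big /=.
rewrite (eq_bigr (fun=> 1%N)) => [|j _]; first by rewrite sum1_card card_ord.
by rewrite (bigD1 (w j)) //= eqxx big1 // => i /negPf; rewrite eq_sym => ->.
Qed.

(** In degrees other than that of the monomial both sides vanish.  The freedom
    in the enumeration e is what makes the order of the factors irrelevant. *)
Lemma component_monomial (I : finType) (e : seq I) (v : I -> V) (r : I -> nat) n :
  perm_eq e (enum I) ->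
  component n (dp_monomial [seq (v i, r i) | i <- e]) = word_sum v r n.+1.
Proof.
move=> pe; rewrite /component /= /dp_monomial_family.
case: eqP => [degn|/eqP]; first exact: dp_tensor_words.
rewrite eq_sym /dp_degree big_map (perm_big _ pe) big_enum /= => degn.
by rewrite word_sum_degree.
Qed.

Lemma perm_enum (I : finType) (e : seq I) :
  uniq e -> (forall i, i \in e) -> perm_eq e (enum I).
Proof.
by move=> ue me; apply: uniq_perm; rewrite ?enum_uniq // => i; rewrite me mem_enum.
Qed.

(** Prefixing a list with one more factor is adding None to its index type. *)
Definition option_enum (I : Type) (e : seq I) : seq (option I) :=
  None :: map Some e.

Lemma perm_option_enum (I : finType) (e : seq I) :
  perm_eq e (enum I) -> perm_eq (option_enum e) (enum {: option I}).
Proof.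
move=> pe; apply: perm_enum => [|[i|]]; rewrite /option_enum //=.
  rewrite map_inj_uniq ?(perm_uniq pe) ?enum_uniq ?andbT; last by move=> ? ? [].
  by apply/mapP => -[].
by rewrite inE map_f ?orbT // (perm_mem pe) mem_enum.
Qed.

Definition with_first (T U : Type) (f : T * nat -> U) (p : T * nat) s
    (o : option 'I_(size s)) : U :=
  oapp (fun i => f (tnth (in_tuple s) i)) (f p) o.

Lemma map_with_first (p : V * nat) s :
  [seq (with_first fst p o, with_first snd p o) | o <- option_enum (enum 'I_(size s))]
  = p :: s.
Proof.
rewrite /= -map_comp /=; congr (_ :: _); first by case: p.
by rewrite -[RHS](map_tnth_enum (in_tuple s)); apply: eq_map => i /=; case: (tnth _ _).
Qed.

Lemma component_cons n (p : V * nat) s :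
  component n (dp_monomial (p :: s)) =
  word_sum (with_first fst p (s := s)) (with_first snd p (s := s)) n.+1.
Proof.
rewrite -(component_monomial _ _ _ (perm_option_enum (perm_refl _))).
by rewrite map_with_first.
Qed.

Lemma dp_monomial_perm (s t : seq (V * nat)) :
  perm_eq s t -> dp_monomial s = dp_monomial t.
Proof.
rewrite -[X in perm_eq _ X]/(val (in_tuple t)) => /tuple_permP[p E].
have pE (u : seq 'I_(size t)) : map (tnth (in_tuple t)) u
    = [seq ((tnth (in_tuple t) i).1, (tnth (in_tuple t) i).2) | i <- u].
  by apply: eq_map => i; case: (tnth _ _).
have {E} -> : s = map (tnth (in_tuple t)) (map p (enum 'I_(size t))).
  by rewrite E -map_comp.
rewrite -[in RHS](map_tnth_enum (in_tuple t) : _ = t) !pE.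
apply: Gamma_ext => n; rewrite !component_monomial //; apply: perm_enum.
  by rewrite map_inj_uniq ?enum_uniq //; apply: perm_inj.
by move=> i; apply/mapP; exists ((p^-1)%g i); rewrite ?mem_enum ?permKV.
Qed.

Lemma dp_monomial_nil : dp_monomial [::] = 0 :> Gamma V.
Proof.
apply: Gamma_ext => n; rewrite linear0 /component /= /dp_monomial_family.
by rewrite /dp_degree big_nil.
Qed.

Lemma eq_word_sum (I : finType) (v v' : I -> V) (r : I -> nat) n :
  (forall i, 0 < r i -> v i = v' i)%N -> word_sum v r n = word_sum v' r n.
Proof.
move=> vv'; apply: eq_bigr => w /has_contentP cw; congr pure; apply: funext => j.
by apply: vv'; rewrite -cw /letter_count (bigD1 j) //= eqxx.
Qed.

Lemma dp_monomial_zero_letter (x y : V) s :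
  dp_monomial ((x, 0%N) :: s) = dp_monomial ((y, 0%N) :: s).
Proof.
by apply: Gamma_ext => n; rewrite !component_cons; apply: eq_word_sum => -[].
Qed.

Definition merge_letter (I : Type) (o : option (option I)) : option I :=
  if o is Some o' then o' else None.

(** A word with letters of the merged alphabet is refined by choosing which of
    its a + b occurrences of the merged letter come from the first of the two
    letters: the fibres are the a-subsets of a set with a + b elements. *)
Lemma card_merge (I : finType) n (u : {ffun 'I_n -> option I})
    (r : option (option I) -> nat) :
  has_content (fun o => if o is Some i then r (Some (Some i))
                        else (r None + r (Some None))%N) u ->
  #|[pred w : {ffun 'I_n -> option (option I)} |
     has_content r w & [ffun j => merge_letter (w j)] == u]|
  = 'C(r None + r (Some None), r None).
Proof.
move=> /has_contentP cu.
pose B := [set j | u j == None].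
have cB : #|B| = (r None + r (Some None))%N.
  rewrite -(cu None) /letter_count -sum1_card big_mkcond /=.
  by apply: eq_bigr => j _; rewrite inE; case: eqP.
rewrite -cB -cards_draws.
pose f (w : {ffun 'I_n -> option (option I)}) : {set 'I_n} := [set j | w j == None].
pose g (A : {set 'I_n}) : {ffun 'I_n -> option (option I)} :=
  [ffun j => if j \in A then None else Some (u j)].
have lc (T : finType) (w : {ffun 'I_n -> T}) i :
    letter_count w i = #|[set j | w j == i]|.
  rewrite /letter_count -sum1_card [RHS]big_mkcond /=.
  by apply: eq_bigr => j _; rewrite inE; case: eqP.
have gK A : f (g A) = A.
  by apply/setP => j; rewrite inE ffunE; case: (j \in A).
have fK (w : {ffun 'I_n -> option (option I)}) :
    [ffun j => merge_letter (w j)] = u -> g (f w) = w.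
  move=> wu; apply/ffunP => j; rewrite ffunE inE -wu ffunE.
  by case: (w j).
rewrite -(card_in_imset (f := f)); last first.
  move=> w w' /andP[_ /eqP wu] /andP[_ /eqP wu'] E.
  by rewrite -(fK w) // E fK.
apply: eq_card => A; rewrite inE.
apply/imsetP/andP => [[w /andP[cw /eqP wu] ->]|[AB /eqP cA]].
  split; last by rewrite -lc (has_contentP _ _ cw).
  by apply/subsetP => j; rewrite !inE -wu ffunE => /eqP ->.
exists (g A); last by rewrite gK.
have mg : [ffun j => merge_letter (g A j)] = u.
  apply/ffunP => j; rewrite !ffunE; case: ifP => //= jA.
  by move/subsetP: AB => /(_ j jA); rewrite inE => /eqP.
rewrite inE mg eqxx andbT; apply/has_contentP => o.
have cN : letter_count (g A) None = r None by rewrite lc -cA -[in RHS](gK A).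
case: o => [[i|]|] //.
  rewrite -(cu (Some i)); apply: eq_bigr => j _; rewrite ffunE; case: ifP => // jA.
  by move/subsetP: AB => /(_ j jA); rewrite inE => /eqP ->.
apply: (@addnI (r None)); rewrite -{1}cN -(cu None) -big_split /=.
apply: eq_bigr => j _; rewrite ffunE; case: ifP => // jA.
by move/subsetP: AB => /(_ j jA); rewrite inE => /eqP ->.
Qed.

Lemma word_sum_merge (I : finType) (v : option I -> V)
    (r : option (option I) -> nat) n :
  word_sum (v \o @merge_letter I) r n =
  'C(r None + r (Some None), r None)%:R *:
    word_sum v (fun o => if o is Some i then r (Some (Some i))
                         else (r None + r (Some None))%N) n.
Proof.
rewrite /word_sum.
set r' := (X in _ = _ *: \sum_(w | has_content X w) _).
rewrite (partition_big (fun w : {ffun 'I_n -> _} => [ffun j => merge_letter (w j)])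
  (has_content r')) /=; last first.
  move=> w /has_contentP cw; apply/has_contentP => -[i|] /=.
    rewrite -cw; apply: eq_bigr => j _; rewrite ffunE.
    by case: (w j) => [[]|].
  rewrite -!cw -big_split; apply: eq_bigr => j _; rewrite ffunE.
  by case: (w j) => [[]|].
rewrite scaler_sumr; apply: eq_bigr => u cu.
rewrite -(card_merge cu) scaler_nat -sumr_const.
apply: eq_big => [w|w /andP[_ /eqP <-]]; first by rewrite inE.
by congr pure; apply: funext => j; rewrite /= ffunE.
Qed.

Lemma dp_monomial_merge (x : V) a b s :
  dp_monomial ((x, a) :: (x, b) :: s) =
  'C(a + b, a)%:R *: dp_monomial ((x, (a + b)%N) :: s).
Proof.
apply: Gamma_ext => n; rewrite linearZ /=.
have -> : (x, a) :: (x, b) :: s =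
   [seq ((with_first fst (x, (a + b)%N) (s := s) \o @merge_letter _) o,
         oapp (with_first snd (x, b) (s := s)) a o)
     | o <- option_enum (option_enum (enum 'I_(size s)))] :> seq (V * nat).
  rewrite -{1}[s](map_tnth_enum (in_tuple s)) /= -!map_comp; congr [:: _, _ & _].
  by apply: eq_map => i /=; case: (tnth _ _).
rewrite component_monomial; last by do 2!apply: perm_option_enum.
rewrite component_cons word_sum_merge.
by congr (_ *: _); apply: eq_bigl => w; apply: eq_forallb => -[].
Qed.

(** A letter of exponent 0 does not occur in any word, so it may be renamed
    after the next letter of the list, and then merged with it. *)
Lemma dp_monomial_zero (x : V) s : dp_monomial ((x, 0%N) :: s) = dp_monomial s.
Proof.
case: s => [|[y b] s]; last first.
  by rewrite (dp_monomial_zero_letter x y) dp_monomial_merge add0n bin0 scale1r.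
(* Gamma has no component of degree 0, so both monomials vanish *)
rewrite dp_monomial_nil; apply: Gamma_ext => n; rewrite linear0 /component /=.
by rewrite /dp_monomial_family /dp_degree big_seq1.
Qed.

Lemma dp_monomial_filter (s : seq (V * nat)) :
  dp_monomial [seq p <- s | 0 < p.2]%N = dp_monomial s.
Proof.
suff H t : dp_monomial (t ++ [seq p <- s | 0 < p.2]%N) = dp_monomial (t ++ s).
  exact: (H [::]).
elim: s t => // -[x [|a]] s IH t /=; last by rewrite -!cat_rcons IH.
rewrite IH -(dp_monomial_zero x); apply: dp_monomial_perm.
by rewrite -cat_cons -(cat1s _ s) perm_sym perm_catCA.
Qed.

(** A letter of exponent 1 sits in exactly one slot of each word, and pure
    tensors are linear in each slot. *)
Lemma word_sum_linear (I : finType) (v : I -> V) (r : I -> nat) n a x y i :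
  r i = 1%N ->
  let v' z := fun k => if k == i then z else v k in
  word_sum (v' (a *: x + y)) r n = a *: word_sum (v' x) r n + word_sum (v' y) r n.
Proof.
move=> ri v'; rewrite /word_sum scaler_sumr -big_split /=.
apply: eq_bigr => w /has_contentP cw.
have /eqP := cw i; rewrite ri /letter_count => /eqP c1.
have [j /eqP wj] : exists j, w j == i.
  apply/existsP; rewrite -[X in is_true X]negbK negb_exists.
  apply/negP => /forallP wi; move: c1; rewrite big1 // => j _.
  by rewrite (negPf (wi j)).
have wk k : (w k == i) = (k == j).
  have [->|kj] := eqVneq k j; first by rewrite wj eqxx.
  move: c1; rewrite (bigD1 j) //= wj eqxx (bigD1 k) //=.
  by case: (w k == i).
have E z : v' z \o w = upd (v \o w) j z.
  by apply: funext => k; rewrite /v' /upd /= wk.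
by rewrite !E pure_multilinear.
Qed.

Definition linear_factor (s : seq (V * nat)) (x : V) : Gamma V :=
  dp_monomial ((x, 1%N) :: s).

Lemma linear_factor_linear s : linear (linear_factor s).
Proof.
move=> a x y; apply: Gamma_ext => n; rewrite linearP /linear_factor /=.
rewrite !component_cons.
have E z : word_sum (with_first fst (z, 1%N) (s := s))
                    (with_first snd (z, 1%N) (s := s)) n.+1
  = word_sum (fun k => if k == None then z else with_first fst (0, 1%N) (s := s) k)
      (with_first snd (0, 1%N) (s := s)) n.+1.
  rewrite (@eq_word_sum _ _ (fun k => if k == None then z
                              else with_first fst (0, 1%N) (s := s) k)).
    by apply: eq_bigl => w; apply: eq_forallb => -[].
  by case.
rewrite !E.
exact: (@word_sum_linear _ (with_first fst (0, 1%N) (s := s)) _ n.+1 a x y None).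
Qed.

HB.instance Definition _ s := GRing.isLinear.Build F V (Gamma V) *:%R
  (linear_factor s) (linear_factor_linear s).

End Components.

(** * The derivative on tensors *)

Section Slotwise.
Variables (F : fieldType) (n : nat).
Implicit Types V W X : lmodType F.

Lemma tensor_slotwise_multilinear V W (f : 'I_n -> {linear V -> W}) :
  multilinear (fun v : 'I_n -> V => pure (fun k => f k (v k))).
Proof.
have E (i : 'I_n) (v : 'I_n -> V) x :
    (fun k => f k (upd v i x k)) = upd (fun k => f k (v k)) i (f i x).
  by apply: funext => k; rewrite /upd; case: eqP => [->|].
by move=> i v a x y; rewrite !E linearP pure_multilinear.
Qed.

Definition tensor_slotwise V W (f : 'I_n -> {linear V -> W}) :
    {linear tensor V n -> tensor W n} :=
  tensor_lift (tensor_slotwise_multilinear f).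

Lemma tensor_slotwise_pure V W (f : 'I_n -> {linear V -> W}) v :
  tensor_slotwise f (pure v) = pure (fun k => f k (v k)).
Proof. exact: tensor_lift_pure. Qed.

Lemma pure_zero_slot V (v : 'I_n -> V) j : v j = 0 -> pure v = 0.
Proof.
move=> vj; have -> : v = upd v j (-1 *: 0 + 0).
  by rewrite scaler0 addr0; apply: funext => k; rewrite /upd; case: eqP => // ->.
by rewrite pure_multilinear scaleN1r addNr.
Qed.

Definition point_slot V (j k : 'I_n) : {linear V -> biprod V V} :=
  if k == j then inj1 V V else inj0 V V.

(** The derivation of the tensor power extending inj1, relative to the
    substitution inj0. *)
Definition tensor_derivative V (t : tensor V n) : tensor (biprod V V) n :=
  \sum_j tensor_slotwise (point_slot V j) t.

Lemma tensor_derivative_linear V : linear (@tensor_derivative V).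
Proof.
move=> a x y; rewrite /tensor_derivative scaler_sumr -big_split /=.
by apply: eq_bigr => j _; rewrite linearP.
Qed.

HB.instance Definition _ V := GRing.isLinear.Build F (tensor V n)
  (tensor (biprod V V) n) *:%R (@tensor_derivative V) (@tensor_derivative_linear V).

Lemma tensor_derivative_pure V (v : 'I_n -> V) :
  tensor_derivative (pure v) = \sum_j pure (fun k => point_slot V j k (v k)).
Proof. by apply: eq_bigr => j _; rewrite tensor_slotwise_pure. Qed.

Lemma tensor_derivative_perm V (s : 'S_n) (t : tensor V n) :
  tensor_perm _ s (tensor_derivative t) = tensor_derivative (tensor_perm _ s t).
Proof.
move: t; apply: (tensor_eq_lin (f := tensor_perm _ s \o @tensor_derivative V)
  (g := @tensor_derivative V \o tensor_perm _ s)) => v /=.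
rewrite tensor_lift_pure !tensor_derivative_pure linear_sum /=.
rewrite [RHS](reindex_inj (@perm_inj _ s)); apply: eq_bigr => j _.
rewrite tensor_lift_pure; congr pure; apply: funext => k /=.
by rewrite /point_slot -(inj_eq (@perm_inj _ s)) permKV.
Qed.

Lemma tensor_map_pure V W (f : {linear V -> W}) (v : 'I_n -> V) :
  tensor_map n f (pure v) = pure (f \o v).
Proof. exact: tensor_lift_pure. Qed.

Lemma tensor_derivative_natural V W (f : {linear V -> W}) (t : tensor V n) :
  tensor_derivative (tensor_map n f t) =
  tensor_map n (biprod_map f f) (tensor_derivative t).
Proof.
move: t; apply: (tensor_eq_lin (f := @tensor_derivative W \o tensor_map n f)
  (g := tensor_map n (biprod_map f f) \o @tensor_derivative V)) => v /=.
rewrite tensor_map_pure !tensor_derivative_pure linear_sum /=.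
apply: eq_bigr => j _; rewrite tensor_map_pure; congr pure; apply: funext => k.
rewrite /point_slot /=; case: eqP => _ /=.
  by rewrite /pairing_fun /= linear0.
by rewrite /pairing_fun /= linear0.
Qed.

Lemma tensor_derivative_proj0 V (t : tensor V n) :
  tensor_map n (proj0 V V) (tensor_derivative t) = 0.
Proof.
move: t; apply: (tensor_eq_lin (f := tensor_map n (proj0 V V) \o @tensor_derivative V)
  (g := zero_lin _ _)) => v /=.
rewrite tensor_derivative_pure linear_sum /= big1 // => j _.
by rewrite tensor_map_pure (@pure_zero_slot _ _ j) //= /point_slot eqxx.
Qed.

Lemma tensor_derivative_diag V (t : tensor V n) :
  tensor_map n (biprod_map (id_lin V) (diag V)) (tensor_derivative t)
  = tensor_map n (biprod_map (id_lin V) (inj0 V V)) (tensor_derivative t)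
    + tensor_map n (biprod_map (id_lin V) (inj1 V V)) (tensor_derivative t).
Proof.
move: t; apply: (tensor_eq_lin
  (f := tensor_map n (biprod_map (id_lin V) (diag V)) \o @tensor_derivative V)
  (g := (tensor_map n (biprod_map (id_lin V) (inj0 V V)) \o @tensor_derivative V)
    \+ (tensor_map n (biprod_map (id_lin V) (inj1 V V)) \o @tensor_derivative V)))
  => v /=.
rewrite tensor_derivative_pure !linear_sum -big_split /=; apply: eq_bigr => j _.
pose u k : biprod V (biprod V V) := (v k, 0).
have E (g : {linear V -> biprod V V}) :
    tensor_map n (biprod_map (id_lin V) g) (pure (fun k => point_slot V j k (v k)))
    = pure (upd u j (0, g (v j))).
  rewrite tensor_map_pure; congr pure; apply: funext => k /=.
  rewrite /upd /point_slot; case: eqP => [->|_] /=; first by [].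
  by rewrite /pairing_fun /= linear0.
rewrite !E -[X in X + _]scale1r -pure_multilinear scale1r; congr (pure (upd _ _ _)).
by congr (_, (_, _)); rewrite /= ?addr0 ?add0r.
Qed.

Lemma tensor_derivative2_pure V (v : 'I_n -> V) :
  tensor_derivative (tensor_derivative (pure v)) =
  \sum_i \sum_j pure (fun k => point_slot _ j k (point_slot V i k (v k))).
Proof.
rewrite tensor_derivative_pure linear_sum; apply: eq_bigr => i _.
exact: tensor_derivative_pure.
Qed.

(** Of the n^2 terms of the second derivative, the projection keeps those that
    differentiate the same slot twice. *)
Lemma tensor_derivative2_proj V (t : tensor V n) :
  tensor_map n (biprod_map (proj0 V V) (proj1 V V))
    (tensor_derivative (tensor_derivative t)) = tensor_derivative t.
Proof.
move: t; apply: (tensor_eq_lin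
  (f := tensor_map n (biprod_map (proj0 V V) (proj1 V V))
        \o @tensor_derivative (biprod V V) \o @tensor_derivative V)
  (g := @tensor_derivative V)) => v /=.
rewrite tensor_derivative2_pure tensor_derivative_pure linear_sum.
apply: eq_bigr => i _; rewrite linear_sum (bigD1 i) //= big1 ?addr0 => [|j ji].
  rewrite tensor_map_pure; congr pure; apply: funext => k /=.
  by rewrite /point_slot; case: eqP.
rewrite tensor_map_pure (@pure_zero_slot _ _ j) //=.
by rewrite /point_slot eqxx (negPf ji).
Qed.

(** The interchange swaps the slots differentiated first and second. *)
Lemma tensor_derivative2_interchange V (t : tensor V n) :
  tensor_map n (Defs.interchange V) (tensor_derivative (tensor_derivative t))
  = tensor_derivative (tensor_derivative t).
Proof.
move: t; apply: (tensor_eq_lin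
  (f := tensor_map n (Defs.interchange V)
        \o @tensor_derivative (biprod V V) \o @tensor_derivative V)
  (g := @tensor_derivative (biprod V V) \o @tensor_derivative V)) => v /=.
rewrite tensor_derivative2_pure linear_sum [RHS]exchange_big.
apply: eq_bigr => i _; rewrite linear_sum; apply: eq_bigr => j _.
rewrite /= tensor_map_pure; congr pure; apply: funext => k /=.
by rewrite /point_slot; case: (k == i); case: (k == j).
Qed.

End Slotwise.

(** * The derivative on Gamma and its values on monomials *)

Section GammaDerivative.
Variable F : fieldType.
Implicit Types V W : lmodType F.

Lemma tensor_derivative_symmetric V n (t : sym_tensor V n) :
  tensor_derivative (sym_val t) \in @symmetric_tensor F (biprod V V) n.
Proof.
apply/forallP => s; rewrite tensor_derivative_perm; case: t => t /= /forallP tP.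
by rewrite (eqP (tP s)).
Qed.

Definition derivative_family V (x : Gamma V) :
    Defs.family (fun n => sym_tensor (biprod V V) n.+1 : lmodType F) :=
  fun n => SymTensor (tensor_derivative_symmetric (dirsum_val x n)).

Lemma derivative_finite V (x : Gamma V) :
  derivative_family x \in @finitely_supported F _.
Proof.
case: x => x xP; have /asboolP[N xN] := xP; apply/asboolP; exists N => n Nn.
by apply: val_inj; rewrite /= xN // linear0.
Qed.

Definition derivative_fun V (x : Gamma V) : Gamma (biprod V V) :=
  DirSum (derivative_finite x).

Lemma component_derivative V (x : Gamma V) n :
  component n (derivative_fun x) = tensor_derivative (component n x).
Proof. by []. Qed.

Lemma derivative_linear V : linear (@derivative_fun V).
Proof.
move=> a x y; apply: Gamma_ext => n.
by rewrite linearP /= !component_derivative linearP.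
Qed.

HB.instance Definition _ V := GRing.isLinear.Build F (Gamma V)
  (Gamma (biprod V V)) *:%R (@derivative_fun V) (@derivative_linear V).

Definition derivative V : {linear Gamma V -> Gamma (biprod V V)} :=
  @derivative_fun V.

Lemma letter_count_point (I : finType) n (w : {ffun 'I_n -> I}) j (o : option I) :
  letter_count [ffun k => if k == j then None else Some (w k)] o =
  if o is Some l then (letter_count w l - (l == w j))%N else 1%N.
Proof.
rewrite /letter_count (bigD1 j) //= ffunE eqxx.
case: o => [l|]; last first.
  rewrite big1 // => k kj.
  by rewrite ffunE (negPf kj).
rewrite [in RHS](bigD1 j) //= (eq_sym l) addKn add0n.
by apply: eq_bigr => k kj; rewrite ffunE (negPf kj).
Qed.

(** D replaces one letter occurrence, say w j = i, by the new letter None.  The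
    pair (w, j) is recovered from the marked word and i, so for each i the
    marked words run once through the words in which i has lost one
    occurrence and None has one. *)
Lemma word_sum_derivative V (I : finType) (v : I -> V) (r : I -> nat) n :
  tensor_derivative (word_sum v r n.+1) =
  \sum_(i | (0 < r i)%N)
    word_sum (fun o => if o is Some l then (v l, 0) else (0, v i))
             (fun o => if o is Some l then (r l - (l == i))%N else 1%N) n.+1.
Proof.
pose P (p : {ffun 'I_n.+1 -> I} * 'I_n.+1) := has_content r p.1.
have wj w j : has_content r w -> (0 < r (w j))%N.
  move=> /has_contentP <-; by rewrite /letter_count (bigD1 j) //= eqxx.
rewrite /word_sum linear_sum /=.
under eq_bigr do rewrite tensor_derivative_pure.
rewrite pair_big_dep /=.
rewrite (partition_big (fun p : {ffun 'I_n.+1 -> I} * 'I_n.+1 => p.1 p.2)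
  (fun i => 0 < r i)%N) /=; last by move=> [w j] /=; rewrite andbT => /wj.
apply: eq_bigr => i ri.
(* h marks an occurrence; h' i puts the letter i back in the marked slot *)
pose h (p : {ffun 'I_n.+1 -> I} * 'I_n.+1) : {ffun 'I_n.+1 -> option I} :=
  [ffun k => if k == p.2 then None else Some (p.1 k)].
pose h' (w : {ffun 'I_n.+1 -> option I}) : {ffun 'I_n.+1 -> I} * 'I_n.+1 :=
  ([ffun k => odflt i (w k)], odflt ord0 [pick k | w k == None]).
rewrite [RHS](reindex_onto h h') /=.
  apply: eq_big => [[w j]|[w j] /andP[_ /eqP wji]] /=; last first.
    congr pure; apply: funext => k; rewrite /point_slot /= ffunE /=.
    by case: eqP => [->|_] /=; rewrite ?wji.
  rewrite andbT.
  have pickj : odflt ord0 [pick k | h (w, j) k == None] = j.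
    case: pickP => [k|/(_ j)] /=; rewrite ffunE /=; last by rewrite eqxx.
    by case: (k =P j).
  have [wji|wji] := eqVneq (w j) i; last first.
    rewrite !andbF; apply/esym/andP => -[_ /eqP[/ffunP/(_ j)]].
    by rewrite !ffunE /= eqxx /= => E; case/eqP: wji.
  rewrite andbT /h' pickj xpair_eqE eqxx andbT.
  have -> : ([ffun k => odflt i (h (w, j) k)] == w) = true.
    by apply/eqP/ffunP => k; rewrite !ffunE /=; case: eqP => //= ->.
  rewrite andbT; apply/has_contentP/has_contentP => cw.
    by case=> [l|]; rewrite letter_count_point ?cw ?wji.
  move=> l; move: (cw (Some l)); rewrite letter_count_point /= wji.
  case: eqP => [->|_]; last by rewrite !subn0.
  have : (0 < letter_count w i)%N by rewrite /letter_count (bigD1 j) //= wji eqxx.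
  by rewrite !subn1 => c0 /(congr1 S); rewrite !prednK.
move=> w /has_contentP cw; have := cw None; rewrite /letter_count => c1.
rewrite /h /h'; case: pickP => [j /eqP wjN|w0] /=; last first.
  by move: c1; rewrite big1 // => k _; rewrite w0.
apply/ffunP => k; rewrite !ffunE /=.
have [->|kj] := eqVneq k j; first by rewrite wjN.
move: c1; rewrite (bigD1 j) //= wjN eqxx (bigD1 k) //=.
by case: (w k).
Qed.

Lemma derivative_monomial V (s : seq (V * nat)) :
  all (fun p => 0 < p.2)%N s ->
  derivative V (dp_monomial s) = \sum_(i < size s) dp_monomial (derivative_term s i).
Proof.
move=> s0; apply: Gamma_ext => n; rewrite [LHS]component_derivative linear_sum /=.
pose v i := (tnth (in_tuple s) i).1; pose r i := (tnth (in_tuple s) i).2.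
have Es : s = [seq (v i, r i) | i <- enum 'I_(size s)].
  apply: etrans (esym (map_tnth_enum (in_tuple s))) _.
  by apply: eq_map => i; rewrite /v /r; case: (tnth _ _).
have r0 i : (0 < r i)%N by apply: (allP s0); apply: mem_tnth.
rewrite {1}Es component_monomial // word_sum_derivative.
apply: eq_big => [i|i _]; first by rewrite r0.
rewrite -(component_monomial (e := rcons (map Some (enum 'I_(size s))) None)).
  congr (component _ (dp_monomial _)).
  rewrite map_rcons -map_comp /derivative_term; congr rcons; last first.
    by rewrite /v (tnth_nth (0, 0%N)).
  rewrite /mkseq -val_enum_ord -map_comp; apply: eq_map => j /=.
  by rewrite /v /r !(tnth_nth (0, 0%N)).
apply: perm_enum => [|o].
  rewrite rcons_uniq map_inj_uniq ?enum_uniq ?andbT; last by move=> ? ? [].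
  by apply/mapP => -[].
rewrite mem_rcons inE; case: o => [l|] //=.
by rewrite map_f // mem_enum.
Qed.

(** All ways of singling out one entry of a list, with the list of the other
    entries.  As monomials do not depend on the order of their factors, sums
    over picks replace sums over positions, and split along concatenations. *)
Fixpoint picks (T : Type) (s : seq T) : seq (T * seq T) :=
  if s is p :: s' then (p, s') :: [seq (q.1, p :: q.2) | q <- picks s'] else [::].

Definition inj0_letters V (s : seq (V * nat)) : seq (biprod V V * nat) :=
  [seq ((p.1, 0), p.2) | p <- s].

(** The term of the derivative of q * t in which the factor q is
    differentiated. *)
Definition pointed V (q : V * nat) (t : seq (V * nat)) : seq (biprod V V * nat) :=
  ((0, q.1), 1%N) :: ((q.1, 0), q.2.-1) :: inj0_letters t.

Lemma picks_map (T U : Type) (f : T -> U) (s : seq T) :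
  picks (map f s) = [seq (f q.1, map f q.2) | q <- picks s].
Proof. by elim: s => //= p s ->; rewrite -!map_comp. Qed.

Lemma picks_cat (T : Type) (s t : seq T) :
  picks (s ++ t) = [seq (q.1, q.2 ++ t) | q <- picks s]
                   ++ [seq (q.1, s ++ q.2) | q <- picks t].
Proof.
elim: s => [|p s IH] /=; first by rewrite -[LHS]map_id; apply: eq_map => -[].
by rewrite IH map_cat -!map_comp.
Qed.

Lemma picks_perm (T : eqType) (s : seq T) q : q \in picks s -> perm_eq (q.1 :: q.2) s.
Proof.
elim: s q => //= p s IH q; rewrite inE => /orP[/eqP -> //|/mapP[q' /IH qs ->]] /=.
by rewrite (perm_catCA [:: q'.1] [:: p] q'.2) perm_cons.
Qed.

(** Picking an entry of a concatenation of lists is picking one of the lists,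
    then one of its entries. *)
Lemma big_picks_flatten (T : eqType) (M : nmodType) (ss : seq (seq T))
    (f : T * seq T -> M) :
  (forall p t t', perm_eq t t' -> f (p, t) = f (p, t')) ->
  \sum_(q <- picks (flatten ss)) f q =
  \sum_(Q <- picks ss) \sum_(q <- picks Q.1) f (q.1, q.2 ++ flatten Q.2).
Proof.
elim: ss f => [|s ss IH] f fP /=; first by rewrite !big_nil.
rewrite picks_cat big_cat big_cons !big_map /=; congr (_ + _).
rewrite (IH (fun q => f (q.1, s ++ q.2))) /=; last first.
  by move=> p t t' tt'; apply: fP; rewrite perm_cat2l.
apply: eq_bigr => Q _; apply: eq_bigr => q _; apply: fP.
by rewrite perm_catCA.
Qed.

Lemma big_picks (T : Type) (M : nmodType) (x0 : T) (s : seq T) (f : T * seq T -> M) :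
  \sum_(q <- picks s) f q =
  \sum_(i < size s) f (nth x0 s i, take i s ++ drop i.+1 s).
Proof.
elim: s f => [|p s IH] f; first by rewrite big_nil big_ord0.
by rewrite big_cons big_map IH big_ord_recl /= drop0.
Qed.

Lemma derivative_term_perm V (s : seq (V * nat)) i : (i < size s)%N ->
  perm_eq (derivative_term s i)
    (pointed (nth (0, 0%N) s i) (take i s ++ drop i.+1 s)).
Proof.
move=> si; rewrite /derivative_term perm_rcons /pointed perm_cons /=.
set p := nth _ s i.
set t := mkseq _ _.
have {t} -> : t = inj0_letters (take i s)
                  ++ ((p.1, 0), p.2.-1) :: inj0_letters (drop i.+1 s).
  apply: (@eq_from_nth _ ((0 : biprod V V), 0%N)).
    rewrite size_mkseq size_cat /= !size_map size_takel ?size_drop; last exact: ltnW.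
    by rewrite -subSn // subSS subnKC // ltnW.
  move=> j; rewrite size_mkseq => js; rewrite nth_mkseq //.
  rewrite nth_cat size_map size_takel; last exact: ltnW.
  case: (ltngtP j i) => ji.
  - by rewrite (nth_map (0, 0%N)) ?size_takel ?nth_take ?subn0 // ltnW.
  - rewrite subn0 -(subnSK ji) /= (nth_map (0, 0%N)); last first.
      by rewrite size_drop ltn_sub2r // (leq_ltn_trans ji).
    by rewrite nth_drop subnKC.
  by rewrite ji subnn /= subn1.
by rewrite /inj0_letters map_cat -cat_rcons perm_sym -cat_cons perm_cat2r perm_sym perm_rcons.
Qed.

Lemma derivative_picks V (s : seq (V * nat)) :
  all (fun p => 0 < p.2)%N s ->
  derivative V (dp_monomial s) = \sum_(q <- picks s) dp_monomial (pointed q.1 q.2).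
Proof.
move=> s0; rewrite derivative_monomial // (big_picks (0, 0%N)).
by apply: eq_bigr => i _; apply/dp_monomial_perm/derivative_term_perm.
Qed.

End GammaDerivative.

(** * Bases inside a spanning family *)

Section Span.
Variables (F : fieldType) (V : lmodType F).

Inductive span (B : V -> Prop) : V -> Prop :=
| span0 : span B 0
| spanS a b v : B b -> span B v -> span B (a *: b + v).

Lemma span_mem (B : V -> Prop) b : B b -> span B b.
Proof. by move=> Bb; rewrite -[b]scale1r -[_ *: _]addr0; apply/spanS/span0. Qed.

Lemma spanD (B : V -> Prop) x y : span B x -> span B y -> span B (x + y).
Proof.
by move=> Sx Sy; elim: Sx => [|a b v Bb _ IH]; rewrite ?add0r // -addrA; apply: spanS.
Qed.

Lemma spanZ (B : V -> Prop) a x : span B x -> span B (a *: x).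
Proof.
elim=> [|c b v Bb _ IH]; first by rewrite scaler0; apply: span0.
by rewrite scalerDr scalerA; apply: spanS.
Qed.

Lemma span_sum (B : V -> Prop) (I : Type) (r : seq I) (P : pred I) (f : I -> V) :
  (forall i, P i -> span B (f i)) -> span B (\sum_(i <- r | P i) f i).
Proof. by move=> Bf; apply: big_ind => //; [apply: span0 | apply: spanD]. Qed.

(** Formal combinations have finite support by construction, so independence
    and coordinates need no bookkeeping of lists of vectors. *)
Definition combination (g : {freeg V / F}) : V := fglift id g.

Lemma combination_linear : linear combination.
Proof.
have cB : {morph combination : x y / x - y} by exact: lift_is_additive.
have c0 : combination 0 = 0 by rewrite -(subrr 0) cB subrr.
have cD : {morph combination : x y / x + y}.
  move=> x y; rewrite -[y in LHS]opprK cB; congr (_ + _).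
  by rewrite -[X in combination X]sub0r cB c0 sub0r opprK.
move=> a x y; rewrite cD; congr (_ + _).
rewrite -[x]freeg_sumE; elim: (dom x) => [|v s IH].
  by rewrite !big_nil scaler0 c0 scaler0.
rewrite !big_cons scalerDr !cD scalerDr IH; congr (_ + _).
have -> : a *: << coeff v x *g v >> = << a * coeff v x *g v >>.
  by apply/eqP/freeg_eqP => w; rewrite coeffZ !coeffU mulrA.
by rewrite /combination !liftU scalerA.
Qed.

HB.instance Definition _ := GRing.isLinear.Build F {freeg V / F} V *:%R
  combination combination_linear.

Definition supported_in (X : V -> Prop) (g : {freeg V / F}) : Prop :=
  forall x, coeff x g != 0 -> X x.

Lemma supported_inP (X : V -> Prop) a g h :
  supported_in X g -> supported_in X h -> supported_in X (a *: g + h).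
Proof.
move=> gX hX x; rewrite coeffD coeffZ => nz.
have [gx|/gX //] := eqVneq (coeff x g) 0.
by move: nz; rewrite gx mulr0 add0r; apply: hX.
Qed.

Definition independent (X : V -> Prop) : Prop :=
  forall g, supported_in X g -> combination g = 0 -> g = 0.

(** A maximal independent subset X of B, given by Zorn's lemma: the union of a
    chain is independent because a formal combination has finite support, and
    if some b in B were not a combination of X, then X with b added would be
    independent. *)
Lemma basis_of_span (B : V -> Prop) :
  (forall v, span B v) ->
  exists X : V -> Prop, [/\ forall x, X x -> B x, independent X
    & forall v, exists2 g, supported_in X g & combination g = v].
Proof.
move=> Bspan.
pose P (X : classical_sets.set V) := (forall x, X x -> B x) /\ independent X.
have [C CP Ctot|X [[XB Xind] Xmax]] := @classical_sets.Zorn_bigcup V P.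
  split=> [x [X /CP[XB _] /XB] //|g gU g0].
  (* the finite support of g lies in a single member of the chain *)
  have : dom g != [::] -> exists2 X, C X & forall x, x \in dom g -> X x.
    have : forall x, x \in dom g -> exists2 X, C X & X x.
      by move=> x; rewrite mem_dom => /gU [X CX Xx]; exists X.
    elim: (dom g) => // x [|y s] IH inU _.
      have [X CX Xx] := inU x (mem_head _ _); exists X => // z.
      by rewrite inE => /eqP ->.
    have [||X CX Xs] := IH; [by move=> z zs; apply: inU; rewrite inE zs orbT|by []|].
    have [Y CY Yx] := inU x (mem_head _ _).
    have [XY|YX] := Ctot X Y CX CY.
      by exists Y => // z; rewrite inE => /orP[/eqP -> //|/Xs /XY].
    by exists X => // z; rewrite inE => /orP[/eqP ->|/Xs //]; apply: YX.
  rewrite dom_eq0; have [//|_ /(_ isT)[X /CP[_ Xind] gX]] := eqVneq g 0.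
  by apply: Xind => // x; rewrite -mem_dom => /gX.
exists X; split => // v.
suff Bcomb b : B b -> exists2 g, supported_in X g & combination g = b.
  elim: (Bspan v) => [|a b w /Bcomb[g gX <-] _ [h hX <-]].
    by exists 0; rewrite ?linear0 // => x; rewrite coeff0 eqxx.
  by exists (a *: g + h); [apply: supported_inP | rewrite linearP].
move=> Bb; have [Xb|nXb] := pselect (X b).
  exists << 1 *g b >>; last by rewrite /combination liftU scale1r.
  by move=> x; rewrite coeffU; case: (b =P x) => [<- //|_]; rewrite mulr0 eqxx.
have /(_ _)/not_andP := Xmax (fun x => X x \/ x = b); case.
  split; first by move=> x Xx; left.
  by move=> /(_ b (or_intror erefl)).
  by move=> nB; exfalso; apply: nB => x [/XB //|->].
move=> /existsNP[g /not_implyP[gX /not_implyP[g0 /eqP gn0]]].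
pose c := coeff b g.
(* b = - c^-1 (g - c b), a combination of elements of X *)
pose h := g - << c *g b >>.
have hX : supported_in X h.
  move=> x; rewrite coeffB coeffU; case: (b =P x) => [<-|bx].
    by rewrite mulr1 subrr eqxx.
  by rewrite mulr0 subr0 => /gX[//|/esym].
have cn0 : c != 0.
  apply: contra gn0 => /eqP c0; apply/eqP; apply: Xind => //.
  by have -> : g = h by rewrite /h c0 freegU0 subr0.
exists (- c^-1 *: h).
  rewrite -[_ *: _]addr0; apply: supported_inP => //.
  by move=> x; rewrite coeff0 eqxx.
rewrite linearZ /h linearB /= g0 /combination liftU sub0r scalerN scaleNr opprK.
by rewrite scalerA mulVf ?scale1r.
Qed.

(** Independence makes the coordinates on a basis contained in B unique, hence
    linear. *)
Lemma coordinates (B : V -> Prop) :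
  (forall v, span B v) ->
  exists c : V -> {freeg V / F}, [/\ linear c, forall v, combination (c v) = v
    & forall v, supported_in B (c v)].
Proof.
move=> /basis_of_span[X [XB Xind Xgen]].
have /choice[c cP] : forall v, exists g, supported_in X g /\ combination g = v.
  by move=> v; have [g gX gv] := Xgen v; exists g.
exists c; split => [a x y|v|v x cx]; last by apply/XB/((cP v).1).
  apply/subr0_eq/Xind; last first.
    by rewrite linearB linearP /= !(proj2 (cP _)) subrr.
  rewrite -scaleN1r [_ + _ *: (_ + _)]addrC; apply: supported_inP; last exact: (cP _).1.
  by apply: supported_inP; exact: (cP _).1.
exact: (cP v).2.
Qed.

Lemma combination_seq (g : {freeg V / F}) (l : seq V) :
  uniq l -> {subset dom g <= l} -> combination g = \sum_(x <- l) coeff x g *: x.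
Proof.
move=> ul gl; rewrite -{1}[g]freeg_sumE linear_sum /=.
rewrite (eq_bigr (fun x => coeff x g *: x)) => [|x _]; last by rewrite /combination liftU.
rewrite [RHS](bigID (mem (dom g))) /= [X in _ + X]big1 ?addr0; last first.
  by move=> x /coeff_outdom ->; rewrite scale0r.
rewrite -[RHS]big_filter; apply/perm_big/uniq_perm; rewrite ?uniq_dom ?filter_uniq //.
by move=> x; rewrite mem_filter andb_idr // => /gl.
Qed.

End Span.

(** * Monomials span Gamma *)

Section Expansion.
Variables (F : fieldType) (V : lmodType F) (n : nat).

Definition slot (v : 'I_n -> V) (j : 'I_n) (x : V) : tensor V n := pure (upd v j x).

Lemma slot_linear v j : linear (slot v j).
Proof. by move=> a x y; apply: pure_multilinear. Qed.

HB.instance Definition _ v j := GRing.isLinear.Build F V (tensor V n) *:%R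
  (slot v j) (slot_linear v j).

(** Expansion of the slots in J only, the others already holding letters; J
    grows by one slot at a time. *)
Lemma pure_expand_slots (I : finType) (e : I -> V) (a : 'I_n -> I -> F)
    (J : seq 'I_n) (w0 : {ffun 'I_n -> I}) :
  uniq J ->
  pure (fun j => if j \in J then \sum_i a j i *: e i else e (w0 j)) =
  \sum_(w : {ffun 'I_n -> I} | [forall j, (j \notin J) ==> (w j == w0 j)])
    (\prod_(j <- J) a j (w j)) *: pure (e \o w).
Proof.
elim: J w0 => [|j0 J IH] w0 /=.
  rewrite (big_pred1 w0) ?big_nil ?scale1r //.
  move=> w /=; apply/forallP/eqP => [ww0|-> j]; last exact: eqxx.
  by apply/ffunP => j; apply/eqP/ww0.
case/andP=> j0J uJ.
pose w1 i := [ffun j => if j == j0 then i else w0 j].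
transitivity (\sum_i a j0 i *:
    pure (fun j => if j \in J then \sum_i a j i *: e i else e (w1 i j))).
  transitivity (slot (fun j => if j \in J then \sum_i a j i *: e i else e (w0 j))
    j0 (\sum_i a j0 i *: e i)).
    congr pure; apply: funext => j; rewrite /upd inE.
    by case: eqP => [->|].
  rewrite linear_sum; apply: eq_bigr => i _; rewrite linearZ /=; congr (_ *: pure _).
  apply: funext => j; rewrite /upd ffunE; case: eqP => [->|//].
  by rewrite (negPf j0J).
rewrite [RHS](partition_big (fun w : {ffun 'I_n -> I} => w j0) predT) //=.
apply: eq_bigr => i _; rewrite IH // scaler_sumr; apply: eq_big => w.
  apply/forallP/andP => [ww1|[/forallP ww0 /eqP wi] j].
    split; last by have := ww1 j0; rewrite j0J ffunE eqxx.
    apply/forallP => j; rewrite inE negb_or; apply/implyP => /andP[/negPf jj0 jJ].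
    by have := ww1 j; rewrite jJ ffunE jj0.
  rewrite ffunE; case: (j =P j0) => [->|/eqP jj0]; first by rewrite wi eqxx implybT.
  by have := ww0 j; rewrite inE (negPf jj0).
move=> /forallP/(_ j0); rewrite j0J ffunE eqxx => /eqP wi.
by rewrite scalerA big_cons wi.
Qed.

Lemma pure_expand (I : finType) (e : I -> V) (a : 'I_n -> I -> F) :
  (0 < n)%N ->
  pure (fun j => \sum_i a j i *: e i) =
  \sum_(w : {ffun 'I_n -> I}) (\prod_j a j (w j)) *: pure (e \o w).
Proof.
move=> n0; have [i0 _|I0] := pickP I.
  have := pure_expand_slots e a [ffun=> i0] (enum_uniq 'I_n).
  rewrite (_ : (fun j => _) = fun j => \sum_i a j i *: e i); last first.
    by apply: funext => j; rewrite mem_enum.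
  move=> ->; apply: eq_big => w; last by rewrite big_enum.
  by apply/forallP => j; rewrite mem_enum.
(* with an empty alphabet every slot holds an empty sum *)
rewrite (@pure_zero_slot _ _ _ _ (Ordinal n0)); last first.
  by rewrite big1 // => i; have := I0 i.
by rewrite big1 // => w; have := I0 (w (Ordinal n0)).
Qed.

Lemma product_multilinear (f : 'I_n -> V -> F) :
  (forall j a x y, f j (a *: x + y) = a * f j x + f j y) ->
  @multilinear F V F^o n (fun v => \prod_j f j (v j)).
Proof.
move=> fL i v a x y.
have E z : \prod_j f j (upd v i z j) = f i z * \prod_(j | j != i) f j (v j).
  rewrite (bigD1 i) //= /upd eqxx; congr (_ * _).
  by apply: eq_bigr => j /negPf ->.
by rewrite !E fL mulrDl -mulrA.
Qed.

End Expansion.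

Section GammaSpan.
Variables (F : fieldType) (V : lmodType F) (B : V -> Prop).
Hypothesis Bspan : forall v, span B v.

Definition monomial_in (m : Gamma V) : Prop :=
  exists2 s : seq (V * nat), proper_monomial s & (forall p, p \in s -> B p.1) /\
    m = dp_monomial s.

Lemma span_monomial (s : seq (V * nat)) :
  (forall p, p \in s -> B p.1) -> span monomial_in (dp_monomial s).
Proof.
move=> sB; rewrite -dp_monomial_filter.
have [->|s0] := eqVneq [seq p <- s | 0 < p.2]%N [::].
  by rewrite dp_monomial_nil; apply: span0.
apply: span_mem; exists [seq p <- s | 0 < p.2]%N.
  by rewrite /proper_monomial lt0n size_eq0 s0 filter_all.
by split=> // p; rewrite mem_filter => /andP[_ /sB].
Qed.

Section Coordinates.
Variable c : V -> {freeg V / F}.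
Hypotheses (cL : linear c) (cK : forall v, combination (c v) = v).
Hypothesis cB : forall v, supported_in B (c v).

Lemma coord_product_multilinear n (l : seq V) (w : {ffun 'I_n -> 'I_(size l)}) :
  @multilinear F V F^o n
    (fun v => \prod_j coeff (tnth (in_tuple l) (w j)) (c (v j))).
Proof.
apply: (@product_multilinear _ _ _
  (fun j v => coeff (tnth (in_tuple l) (w j)) (c v))) => j a x y.
by rewrite cL coeffD coeffZ.
Qed.

(** The linear form that extracts from a tensor the coefficient of the word w
    in the letters of l. *)
Definition word_coord n l (w : {ffun 'I_n -> 'I_(size l)}) :
    {linear tensor V n -> F^o} := tensor_lift (coord_product_multilinear w).

Lemma word_coord_perm n l (w : {ffun 'I_n -> 'I_(size l)}) (s : 'S_n) t :
  word_coord w (tensor_perm V s t) = word_coord [ffun j => w (s j)] t.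
Proof.
move: t; apply: (tensor_eq_lin (f := word_coord w \o tensor_perm V s)
  (g := word_coord [ffun j => w (s j)])) => v /=.
rewrite !tensor_lift_pure (reindex_inj (@perm_inj _ s)); apply: eq_bigr => j _.
by rewrite ffunE /= permK.
Qed.

(** A tensor involves finitely many basis vectors.  The expansion is stated for
    every list l containing them so that the lists needed by two summands can
    be joined. *)
Lemma tensor_expand n (t : tensor V n.+1) :
  exists2 l0 : seq V, (forall x, x \in l0 -> B x) &
    forall l, uniq l -> {subset l0 <= l} ->
      t = \sum_(w : {ffun 'I_n.+1 -> 'I_(size l)})
             (word_coord w t : F) *: pure (fun j => tnth (in_tuple l) (w j)).
Proof.
elim/tensor_ind: t => [|a v t [l0 l0B l0P]].
  by exists [::] => // l _ _; rewrite big1 // => w _; rewrite linear0 scale0r.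
exists (l0 ++ flatten [seq dom (c (v j)) | j <- enum 'I_n.+1]).
  move=> x; rewrite mem_cat => /orP[/l0B //|/flatten_mapP[j _]].
  by rewrite mem_dom => /cB.
move=> l ul ll; rewrite {1}(l0P l ul); last first.
  by move=> x xl; apply: ll; rewrite mem_cat xl.
have cv j : v j = \sum_(i < size l)
    coeff (tnth (in_tuple l) i) (c (v j)) *: tnth (in_tuple l) i.
  rewrite -[LHS]cK (combination_seq ul) 1?big_tnth // => x xc; apply: ll.
  rewrite mem_cat; apply/orP; right; apply/flatten_mapP; exists j => //.
  by rewrite mem_enum.
rewrite {1}(funext cv) pure_expand // scaler_sumr -big_split /=.
apply: eq_bigr => w _; rewrite linearP scalerDl /=; congr (_ + _).
by rewrite tensor_lift_pure scalerA.
Qed.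

(** By invariance the coefficient of a word is unchanged when the word is
    rearranged, so it depends only on the content r; the words of content r
    then add up to the monomial with exponents r. *)
Lemma sym_tensor_expand n (t : sym_tensor V n.+1) :
  exists2 y : Gamma V, span monomial_in y &
    component n y = sym_val t /\ forall k, k != n -> component k y = 0.
Proof.
have [l0 l0B /(_ (undup l0) (undup_uniq l0)) tE] := tensor_expand (sym_val t).
set l := undup l0 in tE.
have lB x : x \in l -> B x by rewrite mem_undup => /l0B.
have {}tE := tE (fun x xl => etrans (mem_undup l0 x) xl).
pose e i := tnth (in_tuple l) i.
pose cnt (w : {ffun 'I_n.+1 -> 'I_(size l)}) : {ffun 'I_(size l) -> 'I_n.+2} :=
  [ffun i => inord (letter_count w i)].
have cntE w i : cnt w i = letter_count w i :> nat.
  rewrite ffunE inordK // ltnS /letter_count.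
  apply: leq_trans (_ : \sum_(j < n.+1) 1 <= _)%N; last by rewrite sum1_card card_ord.
  by apply: leq_sum => j _; case: eqP.
have cntP w (r : {ffun 'I_(size l) -> 'I_n.+2}) : (cnt w == r) = has_content (fun i => r i : nat) w.
  apply/eqP/has_contentP => [<- i|wr]; first by rewrite cntE.
  by apply/ffunP => i; apply: val_inj; rewrite /= cntE wr.
(* the common coefficient of the words of content r *)
pose K (r : {ffun 'I_(size l) -> 'I_n.+2}) := if [pick w | cnt w == r] is Some w then (word_coord w (sym_val t) : F) else 0.
have tK w r : cnt w == r -> word_coord w (sym_val t) = K r.
  move=> wr; rewrite /K; case: pickP => [w' w'r|/(_ w)]; last by rewrite wr.
  have [|s ws] := @letter_count_eq _ _ w w'.
    by move=> i; rewrite -!cntE (eqP wr) (eqP w'r).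
  have -> : w' = [ffun j => w (s j)] by apply/ffunP => j; rewrite ffunE ws.
  rewrite -word_coord_perm; case: (t) => u /= /forallP/(_ s)/eqP -> //.
pose m (r : {ffun 'I_(size l) -> 'I_n.+2}) := dp_monomial [seq (e i, r i : nat) | i <- enum 'I_(size l)].
exists (\sum_r K r *: m r).
  apply: span_sum => r _; apply/spanZ/span_monomial => p /mapP[i _ ->] /=.
  by apply: lB; apply: mem_tnth.
have cm k r : component k (m r) = word_sum e (fun i => r i) k.+1.
  exact: component_monomial.
split=> [|k kn]; rewrite linear_sum; last first.
  rewrite big1 // => r _; rewrite linearZ /= cm /K.
  case: pickP => [w|_]; last by rewrite scale0r.
  rewrite cntP => /has_contentP wr; rewrite word_sum_degree ?scaler0 //.
  rewrite -(eq_bigr _ (fun i _ => wr i)) exchange_big /=.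
  rewrite (eq_bigr (fun=> 1%N)) => [|j _]; first by rewrite sum1_card card_ord eqSS eq_sym.
  by rewrite (bigD1 (w j)) //= eqxx big1 // => i /negPf; rewrite eq_sym => ->.
rewrite [RHS]tE (partition_big cnt predT) //=; apply: eq_bigr => r _.
rewrite linearZ /= cm /word_sum scaler_sumr; apply: eq_big => w.
  by rewrite cntP.
by rewrite -cntP => /tK ->.
Qed.

End Coordinates.

Lemma Gamma_span (x : Gamma V) : span monomial_in x.
Proof.
have [c [cL cK cB]] := coordinates Bspan.
have [N] : exists N, forall n, (N <= n)%N -> component n x = 0.
  case: x => x xP; have /asboolP[N xN] := xP; exists N => n Nn.
  by rewrite /component /= xN.
(* subtracting monomials of degree N + 1 removes the top component *)
elim: N x => [|N IH] x xN.
  have -> : x = 0 by apply: Gamma_ext => n; rewrite xN // linear0.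
  exact: span0.
have [y Sy [yN y0]] := sym_tensor_expand cL cK cB (dirsum_val x N).
rewrite -[x](subrK y); apply: spanD => //; apply: IH => n Nn.
rewrite linearB /=; have [->|nN] := eqVneq n N; first by rewrite yN subrr.
by rewrite xN ?y0 ?subr0 // ltn_neqAle eq_sym nN.
Qed.

Lemma linear_eq_monomials (W : lmodType F) (f g : {linear Gamma V -> W}) :
  (forall s, proper_monomial s -> (forall p, p \in s -> B p.1) ->
    f (dp_monomial s) = g (dp_monomial s)) -> f =1 g.
Proof.
move=> fg x; elim: (Gamma_span x) => [|a b v [s sp [sB ->]] _ IH].
  by rewrite !linear0.
by rewrite !linearP fg // IH.
Qed.

End GammaSpan.

(** * The coefficients of the multiplication *)

Section CompositionFactor.

(** The number of ordered partitions of r * k points into r blocks of size k,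
    choosing the blocks one after the other; this form shows that the first
    division in the coefficient is exact. *)
Lemma fact_mul_div r k :
  ((r * k)`! %/ k`! ^ r)%N = (\prod_(i < r) 'C(i.+1 * k, k))%N.
Proof.
suff -> : ((r * k)`! = \prod_(i < r) 'C(i.+1 * k, k) * k`! ^ r)%N.
  by rewrite mulnK // expn_gt0 fact_gt0.
elim: r => [|r IH]; first by rewrite big_ord0.
rewrite big_ord_recr /= expnSr -(@bin_fact (r.+1 * k) k); last by rewrite mulSn leq_addr.
by rewrite mulSn addKn IH; rewrite [X in ('C(_, _) * X)%N]mulnC -!mulnA mulnCA.
Qed.

Lemma bin_mul_block r k : (0 < k)%N ->
  'C(r.+1 * k, k) = (r.+1 * 'C((r.+1 * k).-1, k.-1))%N.
Proof.
case: k => // k _; apply/eqP; rewrite -(eqn_pmul2l (ltn0Sn k)).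
by rewrite -mul_bin_diag [(k.+1 * (_ * _))%N]mulnCA mulnA eqxx.
Qed.

Definition block_product (V : Type) (s : seq (V * nat)) r : nat :=
  \prod_(q <- s) \prod_(i < r) 'C(i.+1 * q.2, q.2).

(** The product of the binomials that appear when the factors of
    (q * t)^[r] are merged with those of a term of the derivative of q * t that
    differentiates the factor q. *)
Definition block_step (V : Type) (q : V * nat) (t : seq (V * nat)) r : nat :=
  ('C((r.+1 * q.2).-1, q.2.-1) * \prod_(p <- t) 'C(r.+1 * p.2, p.2))%N.

Lemma composition_factorE (V : Type) (s : seq (V * nat)) r :
  composition_factor (s, r) = (block_product s r %/ r`!)%N.
Proof.
by rewrite /composition_factor; congr divn; apply: eq_bigr => q _; apply: fact_mul_div.
Qed.

(** The identity C((r + 1) k, k) = (r + 1) C((r + 1) k - 1, k - 1) for the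
    single factor q supplies the r + 1 by which (r + 1)! exceeds r!. *)
Lemma block_product_step (V : Type) (q : V * nat) (t : seq (V * nat)) r :
  (0 < q.2)%N ->
  block_product (q :: t) r.+1 =
  (r.+1 * (block_product (q :: t) r * block_step q t r))%N.
Proof.
move=> k0; rewrite /block_product /block_step.
under eq_bigr do rewrite big_ord_recr /=.
rewrite big_split /= !big_cons bin_mul_block //.
by rewrite -(mulnA r.+1) mulnCA.
Qed.

Lemma fact_dvd_block_product (V : Type) (q : V * nat) (t : seq (V * nat)) r :
  (0 < q.2)%N -> (r`! %| block_product (q :: t) r)%N.
Proof.
move=> k0; elim: r => [|r IH]; first by rewrite dvd1n.
by rewrite block_product_step // factS dvdn_mul // dvdn_mulr.
Qed.

(** Going from r to r + 1 multiplies the coefficient by the binomials of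
    block_step; this is the numerical content of the chain rule. *)
Lemma composition_factor_step (V : Type) (q : V * nat) (t : seq (V * nat)) r :
  (0 < q.2)%N ->
  composition_factor (q :: t, r.+1) =
  (composition_factor (q :: t, r) * block_step q t r)%N.
Proof.
move=> k0; rewrite !composition_factorE block_product_step // factS.
rewrite divnMl // divn_mulAC //; exact: fact_dvd_block_product.
Qed.

Lemma composition_factor_perm (V : eqType) (s t : seq (V * nat)) r :
  perm_eq s t -> composition_factor (s, r) = composition_factor (t, r).
Proof. by move=> st; rewrite /composition_factor (perm_big _ st). Qed.

Lemma composition_factor_pos (V : Type) (s : seq (V * nat)) r :
  composition_factor ([seq q <- s | 0 < q.2]%N, r) = composition_factor (s, r).
Proof.
rewrite /composition_factor /= big_filter [in RHS](bigID (fun q => 0 < q.2)%N) /=.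
rewrite [X in (_ * X)%N]big1 ?muln1 // => q; rewrite -eqn0Ngt => /eqP ->.
by rewrite muln0 fact0 exp1n.
Qed.

Lemma composition_factor0 (V : Type) (s : seq (V * nat)) :
  composition_factor (s, 0%N) = 1%N.
Proof. by rewrite /composition_factor /= big1 // => q _; rewrite mul0n. Qed.

Lemma composition_factor1 (V : Type) (s : seq (V * nat)) :
  composition_factor (s, 1%N) = 1%N.
Proof.
rewrite /composition_factor /= big1 // => q _.
by rewrite mul1n expn1 divnn fact_gt0.
Qed.

End CompositionFactor.

(** * Compatibility of the derivative with the multiplication *)

Section Multiplication.
Variables (F : fieldType) (M : monad (Gamma_functor F)).
Hypothesis M_dp : is_divided_power_monad M.

Definition scale_exponents (V : Type) r (s : seq (V * nat)) : seq (V * nat) :=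
  [seq (q.1, (r * q.2)%N) | q <- s].

Lemma filter_scale_exponents (V : Type) r (s : seq (V * nat)) : (0 < r)%N ->
  [seq q <- scale_exponents r s | 0 < q.2]%N
  = scale_exponents r [seq q <- s | 0 < q.2]%N.
Proof.
move=> r0; rewrite /scale_exponents filter_map; congr map.
by apply: eq_filter => q /=; rewrite muln_gt0 r0.
Qed.

(** The formula for the multiplication also holds when some exponents vanish,
    as happens after differentiating: such factors contribute 1 to the
    coefficient and nothing to the monomial. *)
Lemma mult_monomial (V : lmodType F) (s : seq (seq (V * nat) * nat)) :
  has (fun p => 0 < p.2)%N s -> all (fun p => has (fun q => 0 < q.2)%N p.1) s ->
  mmult M V (dp_monomial [seq (dp_monomial p.1, p.2) | p <- s] : Gamma (Gamma V))
  = (\prod_(p <- s) composition_factor p)%:R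
    *: dp_monomial (flatten [seq scale_exponents p.2 p.1 | p <- s]).
Proof.
move=> hs /allP hp.
pose pos (u : seq (V * nat)) := [seq q <- u | 0 < q.2]%N.
pose s' := [seq (pos p.1, p.2) | p <- s & (0 < p.2)%N].
have -> : dp_monomial [seq (dp_monomial p.1, p.2) | p <- s] =
          dp_monomial [seq (dp_monomial p.1, p.2) | p <- s'].
  rewrite -[LHS]dp_monomial_filter filter_map -map_comp; congr dp_monomial.
  by apply: eq_map => p /=; rewrite dp_monomial_filter.
have [_ ->] := M_dp.
- congr (_%:R *: _).
    rewrite big_map big_filter [RHS](bigID (fun p => 0 < p.2)%N) /=.
    rewrite [X in (_ * X)%N]big1 ?muln1 => [|[u r] /=]; last first.
      by rewrite -eqn0Ngt => /eqP ->; apply: composition_factor0.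
    by apply: eq_bigr => -[u r] _; apply: composition_factor_pos.
  rewrite -[LHS]dp_monomial_filter -[RHS]dp_monomial_filter; congr dp_monomial.
  rewrite /s'; elim: (s) => //= -[u [|r]] t IH /=; rewrite !filter_cat IH.
    rewrite (_ : filter _ (scale_exponents 0 u) = [::]) //.
    by rewrite /scale_exponents filter_map /= filter_pred0.
  rewrite -[map _ (pos u)]/(scale_exponents r.+1 (pos u)).
  by rewrite !filter_scale_exponents // filter_id.
- rewrite /proper_monomial size_map size_filter -has_count hs.
  by rewrite all_map; apply/allP => p; rewrite mem_filter => /andP[].
- rewrite all_map; apply/allP => p; rewrite mem_filter => /andP[_ /hp /= hq].
  by rewrite /proper_monomial size_filter -has_count hq filter_all.
Qed.

End Multiplication.

Section MergeAll.
Variables (F : fieldType) (V : lmodType F).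

Lemma dp_monomial_catCA (s t u : seq (V * nat)) :
  dp_monomial (s ++ t ++ u) = dp_monomial (t ++ s ++ u).
Proof. by apply: dp_monomial_perm; rewrite perm_catCA. Qed.

Lemma dp_monomial_to_front (p : V * nat) (s t : seq (V * nat)) :
  dp_monomial (s ++ p :: t) = dp_monomial (p :: s ++ t).
Proof. exact: (dp_monomial_catCA s [:: p] t). Qed.

Lemma dp_monomial_merge_all (t c : seq (V * nat)) r :
  dp_monomial (t ++ scale_exponents r t ++ c) =
  (\prod_(q <- t) 'C(r.+1 * q.2, q.2))%:R *:
    dp_monomial (scale_exponents r.+1 t ++ c).
Proof.
elim: t c => [|[x k] t IH] c; first by rewrite big_nil scale1r.
rewrite big_cons /=.
set A := scale_exponents r t; set S := scale_exponents r.+1 t.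
rewrite -cat_cons dp_monomial_to_front /= (dp_monomial_to_front _ [:: (x, (r * k)%N)]).
rewrite dp_monomial_merge catA -dp_monomial_to_front -catA IH dp_monomial_to_front.
by rewrite scalerA -natrM -mulSn.
Qed.

End MergeAll.

Section Leibniz.
Variables (F : fieldType) (V : lmodType F).

Lemma scale_exponents_inj0 r (s : seq (V * nat)) :
  scale_exponents r (inj0_letters s) = inj0_letters (scale_exponents r s).
Proof. by rewrite /scale_exponents /inj0_letters -!map_comp. Qed.

Lemma inj0_letters_cat (s t : seq (V * nat)) :
  inj0_letters (s ++ t) = inj0_letters s ++ inj0_letters t.
Proof. exact: map_cat. Qed.

(** The copy of q gives ((q.1, 0), q.2 - 1) in the pointed part and
    ((q.1, 0), r q.2) in the other, which merge to the exponent
    (r + 1) q.2 - 1; the letters of t merge without the shift by 1. *)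
Lemma pointed_merge (q : V * nat) (t c : seq (V * nat)) r :
  (0 < q.2)%N ->
  dp_monomial (pointed q t ++ inj0_letters (scale_exponents r (q :: t) ++ c)) =
  (block_step q t r)%:R *:
    dp_monomial (pointed (q.1, (r.+1 * q.2)%N) (scale_exponents r.+1 t ++ c)).
Proof.
case: q => v [//|k] _; rewrite /pointed /block_step /=.
rewrite !inj0_letters_cat -!scale_exponents_inj0.
set A := inj0_letters t; set C := inj0_letters c.
pose y n : biprod V V * nat := ((v, 0), n); pose a : biprod V V * nat := ((0, v), 1%N).
rewrite -[LHS]/(dp_monomial ([:: a, y k & A] ++ y (r * k.+1)%N :: scale_exponents r A ++ C)).
rewrite dp_monomial_to_front.
rewrite (dp_monomial_to_front (y k) [:: y (r * k.+1)%N; a]) dp_monomial_merge.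
rewrite -/(y _) -[_ :: a :: _]/([:: y (k + r * k.+1)%N; a] ++ A ++ _ ++ C).
rewrite [A ++ _]catA dp_monomial_catCA -catA dp_monomial_merge_all scalerA -natrM.
by rewrite big_map dp_monomial_catCA /= (dp_monomial_to_front a [:: _]).
Qed.

End Leibniz.

Lemma composition_factor_inj0 (F : fieldType) (V : lmodType F)
    (s : seq (V * nat)) r :
  composition_factor (inj0_letters s, r) = composition_factor (s, r).
Proof. by rewrite /composition_factor big_map. Qed.

Section ChainRule.
Variables (F : fieldType) (M : monad (Gamma_functor F)).
Hypothesis M_dp : is_divided_power_monad M.
Variable V : lmodType F.

Definition chain_rule_rhs : {linear Gamma (Gamma V) -> Gamma (biprod V V)} :=
  mmult M (biprod V V) \o
  (Gamma_map (copairing (Gamma_map (inj0 V V)) (derivative V))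
   \o derivative (Gamma V)).

Definition eval_letters (W : lmodType F) (S : seq (seq (W * nat) * nat)) :
    seq (Gamma W * nat) := [seq (dp_monomial p.1, p.2) | p <- S].

Lemma letters_of_monomials (s : seq (Gamma V * nat)) :
  (forall p, p \in s -> monomial_in (fun=> True) p.1) ->
  exists2 S, s = eval_letters S & all (fun p => proper_monomial p.1) S.
Proof.
elim: s => [|[m r] s IH] sm; first by exists [::].
have [S -> Sp] := IH (fun p ps => sm p (mem_behead (s := (m, r) :: s) ps)).
have [u up [_ /= ->]] := sm _ (mem_head _ _).
by exists ((u, r) :: S); rewrite //= up.
Qed.

(** The copairing sends (m, 0) to the image of m under inj0 and (0, m) to the
    derivative of m; the latter is a factor of exponent 1, so the sum over the
    terms of the derivative comes out of the monomial. *)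
Lemma copairing_pointed (p : seq (V * nat) * nat) (S : seq (seq (V * nat) * nat)) :
  proper_monomial p.1 ->
  Gamma_map (copairing (Gamma_map (inj0 V V)) (derivative V))
    (dp_monomial (pointed (dp_monomial p.1, p.2) (eval_letters S)))
  = \sum_(q <- picks p.1) dp_monomial (eval_letters
      [:: (pointed q.1 q.2, 1%N), (inj0_letters p.1, p.2.-1)
        & [seq (inj0_letters p'.1, p'.2) | p' <- S]]).
Proof.
case/andP=> _ p0; rewrite Gamma_map_monomial /=.
have cop0 (u : seq (V * nat)) :
    copairing_fun (Gamma_map (inj0 V V)) (derivative V) (dp_monomial u, 0)
    = dp_monomial (inj0_letters u).
  rewrite /copairing_fun [derivative V _]linear0 addr0.
  by rewrite [LHS]Gamma_map_monomial.
rewrite cop0 {1}/copairing_fun [Gamma_map _ _]linear0 add0r /=.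
rewrite [derivative_fun _]derivative_picks //.
rewrite -[dp_monomial (_ :: _)]/(linear_factor _ _) linear_sum /=.
apply: eq_bigr => q _; congr (dp_monomial [:: _, _ & _]).
by rewrite /eval_letters -!map_comp; apply: eq_map => p' /=; rewrite cop0.
Qed.

(** Both sides are linear, and monomials of monomials span.  On such a monomial
    both sides are indexed by an outer factor p = (u, r) with the remaining ones
    T, and a factor q of u with the remaining ones t; corresponding terms agree
    by pointed_merge and composition_factor_step. *)
Lemma chain_rule (x : Gamma (Gamma V)) :
  derivative V (mmult M V x) = chain_rule_rhs x.
Proof.
apply: (@linear_eq_monomials _ (Gamma V) (monomial_in (fun=> True)) _ _
  (derivative V \o mmult M V) chain_rule_rhs) x.
  by apply: Gamma_span => v; apply: span_mem.
move=> s sp /letters_of_monomials[S Es Sp].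
have {sp} /andP[S0 Sr] : proper_monomial S.
  by move: sp; rewrite Es /proper_monomial /eval_letters size_map all_map.
have Spos p : p \in S -> all (fun q => 0 < q.2)%N p.1.
  by move/(allP Sp)/andP => [].
have Shas p : p \in S -> has (fun q => 0 < q.2)%N p.1.
  move/(allP Sp)/andP => []; case: (p.1) => //= q u _ /andP[-> _] //.
have hasS : has (fun p => 0 < p.2)%N S.
  by case: (S) S0 Sr => //= p u _ /andP[-> _].
rewrite {s}Es /= (mult_monomial M_dp hasS); last exact/allP.
rewrite linearZ /= [derivative_fun _]derivative_picks; last first.
  apply/allP => _ /flatten_mapP[p pS /mapP[q qp ->]] /=.
  by rewrite muln_gt0 (allP Sr p pS) (allP (Spos p pS)).
rewrite big_picks_flatten; last first.
  by move=> p t t' tt'; apply: dp_monomial_perm; rewrite /pointed !perm_cons perm_map.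
rewrite picks_map big_map [derivative_fun _]derivative_picks; last first.
  by rewrite all_map; apply/allP => p /(allP Sr).
rewrite picks_map big_map !linear_sum /= [LHS]big_seq [RHS]big_seq.
apply: eq_bigr => -[p T] /picks_perm /= pT.
have TS p' : p' \in T -> p' \in S.
  by move=> p'T; rewrite -(perm_mem pT) inE p'T orbT.
have pS : p \in S by rewrite -(perm_mem pT) mem_head.
rewrite [Gamma_fun _ _]copairing_pointed; last exact: (allP Sp).
rewrite picks_map big_map !linear_sum /= [LHS]big_seq [RHS]big_seq.
apply: eq_bigr => -[q t] /picks_perm /= qt.
rewrite [RHS](mult_monomial M_dp (s := [:: (pointed q t, 1%N),
  (inj0_letters p.1, p.2.-1) & [seq (inj0_letters p'.1, p'.2) | p' <- T]])) //=;
  last first.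
  rewrite /pointed /= all_map; apply/andP; split.
    by rewrite /inj0_letters has_map; apply: Shas.
  by apply/allP => p' /TS /Shas; rewrite /inj0_letters /= has_map.
rewrite -(perm_big _ pT) !big_cons big_map composition_factor1 mul1n /=.
case: p pT pS qt => u [|r] pT pS qt; first by have := allP Sr _ pS.
have q0 : (0 < q.2)%N by apply: (allP (Spos _ pS)); rewrite -(perm_mem qt) mem_head.
set C := flatten [seq scale_exponents p'.2 p'.1 | p' <- T].
have -> : flatten [seq scale_exponents p'.2 p'.1
                    | p' <- [seq (inj0_letters p'.1, p'.2) | p' <- T]] = inj0_letters C.
  rewrite /C /inj0_letters map_flatten -!map_comp; congr flatten.
  by apply: eq_map => p' /=; apply: scale_exponents_inj0.
rewrite -[_ :: _ :: _ ++ _]/(scale_exponents 1 (pointed q t) ++ _ ++ _).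
rewrite (_ : scale_exponents 1 _ = pointed q t); last first.
  by rewrite /scale_exponents -[RHS]map_id; apply: eq_map => -[x k] /=; rewrite mul1n.
rewrite [in RHS](@dp_monomial_perm _ _ _ (pointed q t
    ++ inj0_letters (scale_exponents r (q :: t) ++ C))); last first.
  rewrite inj0_letters_cat -scale_exponents_inj0 perm_cat2l perm_cat2r.
  by do 2!apply: perm_map; rewrite perm_sym.
rewrite pointed_merge // scalerA -natrM composition_factor_inj0.
rewrite -(composition_factor_perm _ qt) composition_factor_step //.
rewrite -(composition_factor_perm _ qt) mulnAC; congr ((_ * _)%:R *: _).
by congr muln; apply: eq_bigr => p' _; rewrite composition_factor_inj0; case: p'.
Qed.

End ChainRule.

(** * The theorem *)

Theorem proposition6p3 (F : fieldType) (M : monad (Gamma_functor F))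
    (M_dp : is_divided_power_monad M) :
  exists d : forall V : lmodType F, {linear Gamma V -> Gamma (biprod V V)},
    [/\ is_divided_power_derivative d,
        forall d' : forall V : lmodType F, {linear Gamma V -> Gamma (biprod V V)},
          is_divided_power_derivative d' ->
          forall (V : lmodType F) (x : Gamma V), d' V x = d V x
      & is_differential_combinator M d].
Proof.
have dder : is_divided_power_derivative (@derivative F).
  by move=> V s /andP[_ s0]; apply: derivative_monomial.
exists (@derivative F); split => //.
  move=> d' d'der V; apply: (@linear_eq_monomials _ _ (fun=> True)).
    by move=> v; apply: span_mem.
  by move=> s sp _; rewrite d'der // [RHS]dder.
split.
- by move=> V W f x; apply: Gamma_ext => n; apply: tensor_derivative_natural.
- by move=> V x; apply: Gamma_ext => n; rewrite linear0; apply: tensor_derivative_proj0.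
- move=> V x; apply: Gamma_ext => n; rewrite linearD; exact: tensor_derivative_diag.
- move=> V v; rewrite !M_dp.1 [LHS]dder // big_ord_recl big_ord0 addr0.
  by rewrite [LHS]dp_monomial_zero.
- by move=> V x; apply: chain_rule.
- by move=> V x; apply: Gamma_ext => n; apply: tensor_derivative2_proj.
- by move=> V x; apply: Gamma_ext => n; apply: tensor_derivative2_interchange.
Qed.
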